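(* The spaces $AHHol_3^{LF}(\mathbb{C}P^3)$, $AHarm_3^{+}(S^4)$ and $AHarm_3^{-}(S^4)$ are path-connected.
   Context: Identify $S^2=\mathbb{C}P^1=\mathbb{C}\cup\{\infty\}$ with coordinate $z$, so that the antipodal map is $z\mapsto-1/\bar z$. The twistor fibration $\pi:\mathbb{C}P^3\to S^4\subset\mathbb{C}^2\oplus\mathbb{R}=\mathbb{R}^5$ is $$\pi([z_1,z_2,z_3,z_4])=\frac{\left(2(\bar z_1z_3+z_2\bar z_4),\,2(\bar z_1z_4-z_2\bar z_3),\,|z_1|^2+|z_2|^2-|z_3|^2-|z_4|^2\right)}{|z_1|^2+|z_2|^2+|z_3|^2+|z_4|^2}.$$ A holomorphic curve $\psi=[f_1,f_2,f_3,f_4]:S^2\to\mathbb{C}P^3$ is horizontal if it is tangent to the orthogonal complement (for the Fubini-Study metric) of the fibers of $\pi$; equivalently $f_1'f_2-f_1f_2'+f_3'f_4-f_3f_4'=0$. It is linearly full if its image lies in no projective hyperplane. A holomorphic curve of degree $d$ is written $[f_1,f_2,f_3,f_4]$ with $f_i$ polynomials without common zeros and maximal degree $d$. $HHol_d^{LF}(\mathbb{C}P^3)$ is the set of linearly full horizontal holomorphic curves $S^2\to\mathbb{C}P^3$ of degree $d$, with the topology induced from $P((\mathbb{C}[z]_d)^4)$, where $\mathbb{C}[z]_d$ is the vector space of polynomials of degree at most $d$. $AHHol_d^{LF}(\mathbb{C}P^3)\subset HHol_d^{LF}(\mathbb{C}P^3)$ is the subspace of those $\psi$ for which $\pi\circ\psi$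 is invariant under the antipodal map of $S^2$. $Harm_d^{LF}(S^4)$ is the set of linearly full (image not in a hyperplane of $\mathbb{R}^5$ through the origin) harmonic maps $S^2\to S^4$ with induced area $4\pi d$, with the compact-open topology. It is the disjoint union of $Harm_d^{\pm}(S^4)=\{\pm\pi\circ\psi:\psi\in HHol_d^{LF}(\mathbb{C}P^3)\}$. $AHarm_d^{\pm}(S^4)\subset Harm_d^{\pm}(S^4)$ is the subspace of maps invariant under the antipodal map of $S^2$ (i.e. factoring through $\mathbb{R}P^2$). *)

(* Defs.v *)
From HB Require Import structures.
From mathcomp Require Import all_boot all_order all_algebra.
From mathcomp Require Import generic_quotient complex.
From mathcomp Require Import all_classical all_reals all_analysis.

Set Implicit Arguments.
Unset Strict Implicit.
Unset Printing Implicit Defensive.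

Import Order.TTheory GRing.Theory Num.Theory.
Import numFieldNormedType.Exports.

Local Open Scope classical_set_scope.
Local Open Scope ring_scope.
Local Open Scope complex_scope.
Local Open Scope quotient_scope.

(* The usual topology of the complex plane, given by the modulus. *)
HB.instance Definition _ (R : realType) := NormedModule.copy R[i] (R[i])^o.

Section Projective.
Variables (R : realType) (m n : nat).

Definition nonzero_mx : set 'M[R[i]]_(m, n) := [set A | A != 0].

Definition proportional (A B : nonzero_mx) : bool :=
  `[< exists2 c : R[i], c != 0 & set_val A = c *: set_val B >].

Lemma proportional_refl : reflexive proportional.
Proof. by move=> A; apply/asboolP; exists 1; rewrite ?oner_neq0 ?scale1r. Qed.

Lemma proportional_sym : symmetric proportional.
Proof.
suff H A B : proportional A B -> proportional B A.
  by move=> A B; apply/idP/idP; exact: H.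
move=> /asboolP[c c0 AB]; apply/asboolP; exists c^-1; first by rewrite invr_eq0.
by rewrite AB scalerA mulVf ?scale1r.
Qed.

Lemma proportional_trans : transitive proportional.
Proof.
move=> B A C /asboolP[c c0 AB] /asboolP[e e0 BC]; apply/asboolP.
by exists (c * e); rewrite ?mulf_neq0// AB BC scalerA.
Qed.

Canonical proportional_equiv :=
  EquivRel proportional proportional_refl proportional_sym proportional_trans.

(* The projective space of the vector space of matrices, with the quotient
   topology. *)
Definition projspace := quotient_topology {eq_quot proportional}.

HB.instance Definition _ := Topological.on projspace.
HB.instance Definition _ := Quotient.on projspace.

End Projective.

Section PathConnected.
Variables (R : realType) (T : topologicalType).

(* As usual in homotopy theory, a path-connected space is nonempty. *)
Definition path_connected (A : set T) : Prop :=
  A !=set0 /\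
  forall x y, A x -> A y -> exists g : R -> T,
    [/\ {within `[0, 1], continuous g}, g 0 = x, g 1 = y &
        forall t, `[0, 1]%classic t -> A (g t)].

End PathConnected.

Section Twistor.
Variable R : realType.
Local Notation C := R[i].

(* S^2 = C u {oo}, with oo = None. *)
Definition sphere2 := one_point_compactification C.
HB.instance Definition _ := Topological.on sphere2.

Definition antipode (p : sphere2) : sphere2 :=
  if p is Some z then (if z == 0 then None else Some (- (z^*)^-1)) else Some 0.

(* The twistor fibration in homogeneous coordinates [v], with C^2 + R
   identified with R^5. *)
Definition twistor (v : 'rV[C]_4) : 'rV[R]_5 :=
  let z1 := v 0 0 in let z2 := v 0 1 in
  let z3 := v 0 2 in let z4 := v 0 3 in
  let N := `|z1| ^+ 2 + `|z2| ^+ 2 + `|z3| ^+ 2 + `|z4| ^+ 2 in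
  let a := 2 * (z1^* * z3 + z2 * z4^*) / N in
  let b := 2 * (z1^* * z4 - z2 * z3^*) / N in
  let c := (`|z1| ^+ 2 + `|z2| ^+ 2 - `|z3| ^+ 2 - `|z4| ^+ 2) / N in
  \row_(k < 5) [:: complex.Re a; complex.Im a; complex.Re b; complex.Im b; complex.Re c]`_k.

Definition hprod (u w : 'rV[C]_4) : C := \sum_i u 0 i * (w 0 i)^*.

(* Tangent vectors of CP^3 at [v] are represented by vectors of C^4 modulo
   C v; this formula does not depend on the representatives. *)
Definition fubini_study (v u w : 'rV[C]_4) : R :=
  complex.Re ((hprod u w * hprod v v - hprod u v * hprod v w)
      / hprod v v ^+ 2).

(* The tangent vector at [v] represented by w is in the kernel of the
   differential of the twistor fibration, i.e., tangent to its fiber. *)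
Definition vertical (v w : 'rV[C]_4) : Prop :=
  forall k, is_derive (0 : R) (1 : R)
    (fun s : R => twistor (v + s%:C *: w) 0 k) 0.

(* The real tangent plane spanned by the complex multiples of the tangent
   vector represented by u is orthogonal to the fiber through [v]. *)
Definition horizontal_at (v u : 'rV[C]_4) : Prop :=
  forall (c : C) (w : 'rV[C]_4), vertical v w -> fubini_study v (c *: u) w = 0.

Section Curves.
Variable d : nat.

(* A quadruple of polynomials of degree at most d is encoded by the matrix
   whose i-th row lists the coefficients of f_i, in increasing degrees. *)
Implicit Types A : 'M[C]_(4, d.+1).

Definition coord_poly A (i : 'I_4) : {poly C} := rVpoly (row i A).

Definition hlift A (z : C) : 'rV[C]_4 := \row_i (coord_poly A i).[z].

Definition dhlift A (z : C) : 'rV[C]_4 := \row_i (coord_poly A i)^`().[z].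

(* The components z^d f_i(1/z): the curve in the coordinate 1/z around oo. *)
Definition chart_oo A : 'M[C]_(4, d.+1) := \matrix_(i, j) A i (rev_ord j).

(* Homogeneous coordinates of the values of the curve [f_1, f_2, f_3, f_4]. *)
Definition curve A (p : sphere2) : 'rV[C]_4 :=
  if p is Some z then hlift A z else hlift (chart_oo A) 0.

Definition has_degree A : Prop :=
  (forall z : C, exists i, (coord_poly A i).[z] != 0) /\
  (\max_(i < 4) size (coord_poly A i) = d.+1)%N.

Definition horizontal A : Prop :=
  (forall z : C, horizontal_at (hlift A z) (dhlift A z)) /\
  horizontal_at (hlift (chart_oo A) 0) (dhlift (chart_oo A) 0).

(* The column h is the equation of a hyperplane. *)
Definition linearly_full A : Prop :=
  forall h : 'cV[C]_4, h != 0 -> exists p, curve A p *m h != 0.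

Definition twistor_curve A : {compact-open, sphere2 -> 'rV[R]_5} :=
  fun p => twistor (curve A p).

Definition antipodal_invariant (g : {compact-open, sphere2 -> 'rV[R]_5}) :
  Prop := forall p, g (antipode p) = g p.

Definition coefs (psi : projspace R 4 d.+1) : 'M[C]_(4, d.+1) :=
  set_val (repr psi).

Definition HHolLF : set (projspace R 4 d.+1) :=
  [set psi | [/\ has_degree (coefs psi), horizontal (coefs psi) &
                 linearly_full (coefs psi)]].

Definition AHHolLF : set (projspace R 4 d.+1) :=
  HHolLF `&` [set psi | antipodal_invariant (twistor_curve (coefs psi))].

Definition Harm_plus : set {compact-open, sphere2 -> 'rV[R]_5} :=
  [set twistor_curve (coefs psi) | psi in HHolLF].

Definition Harm_minus : set {compact-open, sphere2 -> 'rV[R]_5} :=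
  [set (fun p => - twistor_curve (coefs psi) p) | psi in HHolLF].

Definition AHarm_plus := Harm_plus `&` antipodal_invariant.

Definition AHarm_minus := Harm_minus `&` antipodal_invariant.

End Curves.
End Twistor.

(* Main.v *)
Require Import Defs.
From HB Require Import structures.
From mathcomp Require Import all_boot all_order all_algebra.
From mathcomp Require Import generic_quotient complex ring lra.
From mathcomp Require Import all_classical all_reals all_analysis.

(** Write a cubic curve as [f z = A e(z)], with [A] a matrix and
    [e(z) = (1, z, z^2, z^3)]. It is linearly full when [A] is invertible
    ([linearly_full_unit]) and it is horizontal when [f] and its derivative are
    orthogonal for the symplectic form [omega] ([horizontal_atP]). The latter
    gives five equations between the columns of [A] ([horizontal_unit]), saying
    that these columns form a symplectic basis up to constants.

    The fibres of the twistor fibration are the quaternionic lines of C^4, seen as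
    H^2 with multiplication by j given by [quat_j]. Since [quat_j] and the
    antipode are antiholomorphic, applying both to [f] gives another cubic
    curve [g], and the harmonic map of [f] is invariant under the antipode
    exactly when [g z] is in the quaternionic line of [f z] for all [z]. This is an
    identity between polynomials in [z] and its conjugate; polarizing it
    ([polarization]) and using that [f] is linearly full, one finds that [f z] and
    [g z] are proportional ([antipodal_wedge]), and then that [g = c f] for a
    constant [c] ([antipodal_mx_proportional]). It follows that, up to a
    scalar, the columns of [A] are [a, b, - quat_j b, quat_j a], where [a] and
    [b] are orthogonal over the quaternions and the squared norm of [b] is
    three times that of [a] ([antipodal_cubic_frame]). Conversely all such
    matrices give invariant curves ([frame_antipodal_cubic]). So the space of
    invariant curves is a copy of the quotient of Sp(2) by its center.

    It is path-connected because a frame can be written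
    [a = (p x, r y)], [b = sqrt 3 (- p y, r x) s] with unit quaternions
    [p], [r], [s] and real numbers [x], [y] that are not both zero
    ([quat_frame_surj]): one moves each of the parameters along a path. The path of
    matrices obtained in this way projects to a path in the projective space. It also
    gives a path of harmonic maps, since the value of the harmonic map is a
    continuous function of the matrix and of the point of the sphere, including
    at infinity ([twistor_curve_jointly_continuous]). The last two spaces are images of
    the first one by such a map and its opposite. *)

Set Implicit Arguments.
Unset Strict Implicit.
Unset Printing Implicit Defensive.

Import Order.TTheory GRing.Theory Num.Theory.
Import numFieldNormedType.Exports.

Local Open Scope classical_set_scope.
Local Open Scope complex_scope.
Local Open Scope ring_scope.
Local Open Scope quotient_scope.

(** * Vectors of length four and complex conjugation *)

Section Quadruples.
Variable T : nmodType.

Lemma sum_ord4 (F : 'I_4 -> T) : \sum_i F i = F 0 + F 1 + F 2 + F 3.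
Proof.
rewrite !big_ord_recr big_ord0 /= add0r.
by congr (F _ + F _ + F _ + F _); apply: val_inj.
Qed.

End Quadruples.

Lemma forall_ord4 (P : 'I_4 -> Prop) : P 0 -> P 1 -> P 2 -> P 3 -> forall i, P i.
Proof.
move=> P0 P1 P2 P3 [[|[|[|[|//]]]] lti].
- by have -> : Ordinal lti = 0 by apply: val_inj.
- by have -> : Ordinal lti = 1 by apply: val_inj.
- by have -> : Ordinal lti = 2 by apply: val_inj.
- by have -> : Ordinal lti = 3 by apply: val_inj.
Qed.

Section Conjugation.
Variable R : realType.
Local Notation C := R[i].
Implicit Types x y : C.

Lemma conjC_N x : (- x)^* = - x^*. Proof. exact: rmorphN. Qed.
Lemma conjC_D x y : (x + y)^* = x^* + y^*. Proof. exact: rmorphD. Qed.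
Lemma conjC_M x y : (x * y)^* = x^* * y^*. Proof. exact: rmorphM. Qed.
Lemma conjC_real (r : R) : (r%:C)^* = r%:C. Proof. exact: conjc_real. Qed.

Definition conjC_E := (@conjCK C, conjC_N, conjC_D, conjC_M, conjC_real).

End Conjugation.

(** * The quaternionic structure and the fibres of the twistor fibration *)

Section TwistorAlgebra.
Variable R : realType.
Local Notation C := R[i].
Implicit Types u v w : 'rV[C]_4.

(** Right multiplication by the quaternion j, when C^4 is identified with the
    right H-module H^2 by [(z1 + j z2, z3 + j z4)]. *)
Definition quat_j v : 'rV[C]_4 :=
  \row_k [:: - (v 0 1)^*; (v 0 0)^*; - (v 0 3)^*; (v 0 2)^*]`_k.

(** The complex symplectic form that is invariant under the quaternionic unitary
    group, as [omega u (quat_j v)] is the Hermitian product of [u] and [v]. *)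
Definition omega u v : C :=
  u 0 0 * v 0 1 - u 0 1 * v 0 0 + u 0 2 * v 0 3 - u 0 3 * v 0 2.

Lemma quat_jE v : ((quat_j v 0 0 = - (v 0 1)^*) * (quat_j v 0 1 = (v 0 0)^*) *
  (quat_j v 0 2 = - (v 0 3)^*) * (quat_j v 0 3 = (v 0 2)^*))%type.
Proof. by rewrite !mxE. Qed.

Lemma hprodE u w : hprod u w = u 0 0 * (w 0 0)^* + u 0 1 * (w 0 1)^* +
  u 0 2 * (w 0 2)^* + u 0 3 * (w 0 3)^*.
Proof. by rewrite /hprod sum_ord4. Qed.

Lemma hprod_quat_j u v : hprod u (quat_j v) = omega v u.
Proof. by rewrite hprodE !quat_jE !conjC_E /omega; ring. Qed.

Lemma omega_quat_j u v : omega u (quat_j v) = hprod u v.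
Proof. by rewrite hprodE /omega !quat_jE; ring. Qed.

Lemma quat_jK v : quat_j (quat_j v) = - v.
Proof.
by apply/rowP; apply: forall_ord4; rewrite !quat_jE mxE ?conjC_E.
Qed.

Lemma hprodvv_ge0 v : 0 <= hprod v v.
Proof. by apply: sumr_ge0 => i _; exact: mulcJ_ge0. Qed.

Lemma hprodvv_eq0 v : (hprod v v == 0) = (v == 0).
Proof.
rewrite /hprod psumr_eq0; last by move=> i _; exact: mulcJ_ge0.
apply/allP/eqP => [v0|-> i _]; last by rewrite mxE mul0r eqxx.
apply/rowP => i; rewrite mxE; apply/eqP.
by have := v0 i (mem_index_enum i); rewrite /= mulf_eq0 conjC_eq0 orbb.
Qed.

Lemma hprodvv_real v : (complex.Re (hprod v v))%:C = hprod v v.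
Proof. by apply: RRe_real; exact: ger0_real (hprodvv_ge0 v). Qed.

Lemma conj_hprodvv v : (hprod v v)^* = hprod v v.
Proof. by rewrite -hprodvv_real conjC_real. Qed.

(** In quaternionic notation [v = (P, Q)], the pair [(tw_a, tw_b)] encodes the
    product of Q and the conjugate of P, while [tw_p] and [tw_q] are the
    squared norms of P and Q. These are quadratic functions of [v], and [twistor]
    is their class up to positive real scalars. *)
Definition tw_a v : C := (v 0 0)^* * v 0 2 + v 0 1 * (v 0 3)^*.
Definition tw_b v : C := (v 0 0)^* * v 0 3 - v 0 1 * (v 0 2)^*.
Definition tw_p v : C := v 0 0 * (v 0 0)^* + v 0 1 * (v 0 1)^*.
Definition tw_q v : C := v 0 2 * (v 0 2)^* + v 0 3 * (v 0 3)^*.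

Lemma hprodvvE v : hprod v v = tw_p v + tw_q v.
Proof. by rewrite hprodE /tw_p /tw_q !addrA. Qed.

Lemma Re_mul_real (z : C) (r : R) : complex.Re (z * r%:C) = complex.Re z * r.
Proof. by case: z => a b /=; rewrite mulr0 subr0. Qed.

Lemma Im_mul_real (z : C) (r : R) : complex.Im (z * r%:C) = complex.Im z * r.
Proof. by case: z => a b /=; rewrite mulr0 add0r. Qed.

Lemma Re_quadratic (x y z : C) (s : R) :
  complex.Re (x + y * s%:C + z * (s ^+ 2)%:C) =
  complex.Re x + s * complex.Re y + s ^+ 2 * complex.Re z.
Proof.
have ReD (t t' : C) : complex.Re (t + t') = complex.Re t + complex.Re t'.
  by case: t t' => [? ?] [? ?].
by rewrite 2!ReD 2!Re_mul_real; ring.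
Qed.

Lemma Im_quadratic (x y z : C) (s : R) :
  complex.Im (x + y * s%:C + z * (s ^+ 2)%:C) =
  complex.Im x + s * complex.Im y + s ^+ 2 * complex.Im z.
Proof.
have ImD (t t' : C) : complex.Im (t + t') = complex.Im t + complex.Im t'.
  by case: t t' => [? ?] [? ?].
by rewrite 2!ImD 2!Im_mul_real; ring.
Qed.

Lemma twistorE v : twistor v = \row_k
  ([:: complex.Re (2 * tw_a v); complex.Im (2 * tw_a v);
       complex.Re (2 * tw_b v); complex.Im (2 * tw_b v);
       complex.Re (tw_p v - tw_q v)]`_k / complex.Re (hprod v v)).
Proof.
have NE : `|v 0 0| ^+ 2 + `|v 0 1| ^+ 2 + `|v 0 2| ^+ 2 + `|v 0 3| ^+ 2
  = hprod v v by rewrite hprodE !normCK.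
have PQE : `|v 0 0| ^+ 2 + `|v 0 1| ^+ 2 - `|v 0 2| ^+ 2 - `|v 0 3| ^+ 2
  = tw_p v - tw_q v by rewrite !normCK /tw_p /tw_q opprD addrA.
apply/rowP => k; rewrite /twistor !mxE NE PQE -hprodvv_real
  -!fmorphV !Re_mul_real !Im_mul_real /=.
by case: k => [[|[|[|[|[|k]]]]] ltk].
Qed.

Lemma twistor_scaled (l : R) u v : l != 0 ->
  tw_a u = l%:C * tw_a v -> tw_b u = l%:C * tw_b v ->
  tw_p u = l%:C * tw_p v -> tw_q u = l%:C * tw_q v ->
  twistor u = twistor v.
Proof.
move=> l0 uA uB uP uQ; apply/rowP => k; rewrite !twistorE !mxE.
rewrite !hprodvvE uA uB uP uQ -mulrBr -mulrDr !(mulrCA 2)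
  !(mulrC l%:C) !Re_mul_real !Im_mul_real.
case: k => [[|[|[|[|[|k]]]]] ltk] //=; rewrite -mulf_div divff ?mulr1 //.
Qed.

(** The fibre of the twistor fibration through [v] contains the projective line
    of the quaternionic line spanned by [v]: the quadratic functions [tw_a],
    ..., [tw_q] are all multiplied by the squared norm of a quaternion
    [a + j b] when [v] is multiplied by it on the right. *)
Lemma twistor_fiber (a b : C) v : a *: v + b *: quat_j v != 0 ->
  twistor (a *: v + b *: quat_j v) = twistor v.
Proof.
set u := (X in X != 0) => u0.
have uE i : u 0 i = a * v 0 i + b * quat_j v 0 i by rewrite !mxE.
have lE : (complex.Re (a * a^* + b * b^*))%:C = a * a^* + b * b^*.
  by apply: RRe_real; rewrite ger0_real// addr_ge0// mul_conjC_ge0.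
apply: (@twistor_scaled (complex.Re (a * a^* + b * b^*))).
- apply: contra_neq u0 => /(congr1 (fun r : R => r%:C)); rewrite lE => /eqP.
  rewrite paddr_eq0 ?mul_conjC_ge0// !mul_conjC_eq0 => /andP[/eqP a0 /eqP b0].
  by rewrite /u a0 b0 !scale0r addr0.
- by rewrite lE /tw_a !uE !quat_jE !conjC_E; ring.
- by rewrite lE /tw_b !uE !quat_jE !conjC_E; ring.
- by rewrite lE /tw_p !uE !quat_jE !conjC_E; ring.
- by rewrite lE /tw_q !uE !quat_jE !conjC_E; ring.
Qed.

(** [w] is its own orthogonal projection to the quaternionic line of [v], whose
    basis [v], [quat_j v] is orthogonal. Multiplying by [hprod v v] makes all
    terms polynomial. *)
Definition in_quat_line v w : Prop :=
  hprod v v *: w = hprod w v *: v + hprod w (quat_j v) *: quat_j v.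

(** The equations that say that [w] is in the quaternionic line of [v] can be
    written with the quadratic functions of [v] as coefficients. They are
    tautologies when [w = v], so they only depend on the class of these
    functions up to scalars. *)
Lemma in_quat_lineP v w :
  w 0 0 * tw_q v = w 0 2 * (tw_a v)^* + w 0 3 * (tw_b v)^* ->
  w 0 1 * tw_q v = w 0 3 * tw_a v - w 0 2 * tw_b v ->
  w 0 2 * tw_p v = w 0 0 * tw_a v - w 0 1 * (tw_b v)^* ->
  w 0 3 * tw_p v = w 0 1 * (tw_a v)^* + w 0 0 * tw_b v ->
  in_quat_line v w.
Proof.
move=> w0 w1 w2 w3; rewrite /in_quat_line; apply/rowP; apply: forall_ord4;
  rewrite !(mxE, quat_jE) /= hprodvvE hprod_quat_j !hprodE /omega;
  apply/eqP; rewrite -subr_eq0; apply/eqP.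
- rewrite -(subrr (w 0 0 * tw_q v)) {2}w0 /tw_a /tw_b /tw_p /tw_q !conjC_E; ring.
- rewrite -(subrr (w 0 1 * tw_q v)) {2}w1 /tw_a /tw_b /tw_p /tw_q ?conjC_E; ring.
- rewrite -(subrr (w 0 2 * tw_p v)) {2}w2 /tw_a /tw_b /tw_p /tw_q !conjC_E; ring.
- rewrite -(subrr (w 0 3 * tw_p v)) {2}w3 /tw_a /tw_b /tw_p /tw_q !conjC_E; ring.
Qed.

Lemma Re_hprodvv_neq0 v : v != 0 -> complex.Re (hprod v v) != 0.
Proof.
rewrite -hprodvv_eq0; apply: contra_neq => v0.
by rewrite -hprodvv_real v0.
Qed.

Lemma eqC_ReIm (z t : C) :
  complex.Re z = complex.Re t -> complex.Im z = complex.Im t -> z = t.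
Proof. by case: z t => [a b] [c d] /= -> ->. Qed.

Lemma eqC_scaled (z t : C) (l : R) : complex.Re z = complex.Re t * l ->
  complex.Im z = complex.Im t * l -> z = l%:C * t.
Proof.
by rewrite -Re_mul_real -Im_mul_real (mulrC l%:C); exact: eqC_ReIm.
Qed.

Lemma tw_p_real v : (complex.Re (tw_p v))%:C = tw_p v.
Proof. by apply: RRe_real; rewrite ger0_real// addr_ge0// mul_conjC_ge0. Qed.

Lemma tw_q_real v : (complex.Re (tw_q v))%:C = tw_q v.
Proof. by apply: RRe_real; rewrite ger0_real// addr_ge0// mul_conjC_ge0. Qed.

Lemma Re2 (z : C) : complex.Re (2 * z) = 2 * complex.Re z.
Proof. by case: z => a b /=; ring. Qed.

Lemma Im2 (z : C) : complex.Im (2 * z) = 2 * complex.Im z.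
Proof. by case: z => a b /=; ring. Qed.

Lemma twistor_inj u v : u != 0 -> v != 0 -> twistor u = twistor v ->
  exists2 l : R, l != 0 & [/\ tw_a u = l%:C * tw_a v, tw_b u = l%:C * tw_b v,
    tw_p u = l%:C * tw_p v & tw_q u = l%:C * tw_q v].
Proof.
move=> /Re_hprodvv_neq0 u0 /Re_hprodvv_neq0 v0 uv.
exists (complex.Re (hprod u u) / complex.Re (hprod v v)).
  by rewrite mulf_neq0 ?invr_eq0.
have E (k : 'I_5) : twistor u 0 k = twistor v 0 k by rewrite uv.
have := (E 0, E 1, E 2, E 3, E 4); rewrite !twistorE !mxE /= !Re2 !Im2.
case=> -[] [] [] E0 E1 E2 E3 E4.
have UE : complex.Re (hprod u u) = complex.Re (tw_p u) + complex.Re (tw_q u).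
  by rewrite hprodvvE raddfD.
have VE : complex.Re (hprod v v) = complex.Re (tw_p v) + complex.Re (tw_q v).
  by rewrite hprodvvE raddfD.
have cross (a b c d : R) : c != 0 -> d != 0 -> a / c = b / d -> a = c / d * b.
  by move=> c0 d0 e; rewrite -mulrA (mulrC _ b) -e; field.
have E5 : complex.Re (hprod u u) / complex.Re (hprod u u) =
    complex.Re (hprod v v) / complex.Re (hprod v v) by rewrite !divff.
rewrite !raddfB /= in E4.
move: E0 E1 E2 E3 E4 E5 => /cross E0 /cross E1 /cross E2 /cross E3 /cross E4 /cross E5.
have {}E0 := E0 u0 v0; have {}E1 := E1 u0 v0; have {}E2 := E2 u0 v0.
have {}E3 := E3 u0 v0; have {}E4 := E4 u0 v0; have {}E5 := E5 u0 v0.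
set l := _ / _ in E0 E1 E2 E3 E4 E5 *.
clearbody l; rewrite UE VE in E5; clear - E0 E1 E2 E3 E4 E5.
have dbl (x y : R) : 2 * x = l * (2 * y) -> x = y * l by move=> ?; lra.
have sumdif (x y x' y' : R) : x - y = l * (x' - y') -> x + y = l * (x' + y') ->
  x = x' * l /\ y = y' * l by move=> ? ?; split; lra.
have [PE QE] := sumdif _ _ _ _ E4 E5.
split.
- by apply: eqC_scaled; exact: dbl.
- by apply: eqC_scaled; exact: dbl.
- by rewrite -(tw_p_real u) -(tw_p_real v) PE mulrC; exact: rmorphM.
- by rewrite -(tw_q_real u) -(tw_q_real v) QE mulrC; exact: rmorphM.
Qed.

(** If [v] and [w] have the same image, the quadratic functions of [v] in
    the equations of [in_quat_lineP] can be replaced by those of [w]. *)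
Lemma twistor_eq_in_quat_line v w :
  v != 0 -> w != 0 -> twistor v = twistor w -> in_quat_line v w.
Proof.
move=> v0 w0 vw; have [l l0 [vA vB vP vQ]] := twistor_inj v0 w0 vw.
apply: in_quat_lineP; rewrite ?vA ?vB ?vP ?vQ ?conjC_E;
  rewrite /tw_a /tw_b /tw_p /tw_q ?conjC_E; ring.
Qed.

(** The identity says that the numerator of the derivative of the quotient at the
    origin vanishes. *)
Lemma is_derive0_quotient (p q : {poly R}) (f : R -> R) : q`_0 != 0 ->
  (forall s, f s = p.[s] / q.[s]) -> is_derive (0 : R) (1 : R) f 0 ->
  p`_1 * q`_0 = p`_0 * q`_1.
Proof.
rewrite -!horner_coef0 => q0 fE.
have -> : f = horner p * (fun s => q.[s]^-1) by apply/funext => s; rewrite fE.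
have dq := is_deriveV q0 (is_derive_poly q 0).
move=> [_ f0]; have [_ /=] := is_deriveM (is_derive_poly p 0) dq.
rewrite {}f0 => /(congr1 ( *%R (q.[0] ^+ 2))).
rewrite mulr0 -![_ *: _]/(_ * _) !horner_coef0 !coef_deriv !mulr1n.
move=> e; rewrite horner_coef0 in q0; apply/eqP; rewrite -subr_eq0; apply/eqP.
by apply: etrans (esym e); field.
Qed.

(** [dtw_a], [dtw_b], [dtw_p] and [dtw_q] are the derivatives at [v], in the
    direction [w], of the four quadratic functions [tw_a], ..., [tw_q]. *)
Definition dtw_a v w : C := (v 0 0)^* * w 0 2 + (w 0 0)^* * v 0 2 +
  (v 0 1 * (w 0 3)^* + w 0 1 * (v 0 3)^*).
Definition dtw_b v w : C := (v 0 0)^* * w 0 3 + (w 0 0)^* * v 0 3 -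
  (v 0 1 * (w 0 2)^* + w 0 1 * (v 0 2)^*).
Definition dtw_p v w : C := v 0 0 * (w 0 0)^* + w 0 0 * (v 0 0)^* +
  (v 0 1 * (w 0 1)^* + w 0 1 * (v 0 1)^*).
Definition dtw_q v w : C := v 0 2 * (w 0 2)^* + w 0 2 * (v 0 2)^* +
  (v 0 3 * (w 0 3)^* + w 0 3 * (v 0 3)^*).

Lemma tw_line v w (s : R) : [/\
  tw_a (v + s%:C *: w) = tw_a v + dtw_a v w * s%:C + tw_a w * (s ^+ 2)%:C,
  tw_b (v + s%:C *: w) = tw_b v + dtw_b v w * s%:C + tw_b w * (s ^+ 2)%:C,
  tw_p (v + s%:C *: w) = tw_p v + dtw_p v w * s%:C + tw_p w * (s ^+ 2)%:C &
  tw_q (v + s%:C *: w) = tw_q v + dtw_q v w * s%:C + tw_q w * (s ^+ 2)%:C].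
Proof.
have uE i : (v + s%:C *: w) 0 i = v 0 i + s%:C * w 0 i by rewrite !mxE.
have -> : (s ^+ 2)%:C = s%:C ^+ 2 :> C by rewrite rmorphXn.
split.
- by rewrite /tw_a !uE /dtw_a !conjC_E; ring.
- by rewrite /tw_b !uE /dtw_b !conjC_E; ring.
- by rewrite /tw_p !uE /dtw_p !conjC_E; ring.
- by rewrite /tw_q !uE /dtw_q !conjC_E; ring.
Qed.

Lemma is_derive0_quadratic_quotient (a b c A B D : R) (f : R -> R) : A != 0 ->
  (forall s, f s = (a + s * b + s ^+ 2 * c) / (A + s * B + s ^+ 2 * D)) ->
  is_derive (0 : R) (1 : R) f 0 -> b * A = a * B.
Proof.
move=> A0 fE f0.
have := @is_derive0_quotient (Poly [:: a; b; c]) (Poly [:: A; B; D]) f.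
rewrite !coef_Poly; apply => // s; rewrite !horner_Poly /= fE; congr (_ / _); ring.
Qed.

(** A direction that is killed by the differential of the quotients
    [tw_a / hprod v v], ... is one in which the numerators and the
    denominator have proportional derivatives. *)
Lemma vertical_derivatives v w : v != 0 -> vertical v w ->
  [/\ dtw_a v w * hprod v v = tw_a v * (dtw_p v w + dtw_q v w),
       dtw_b v w * hprod v v = tw_b v * (dtw_p v w + dtw_q v w),
       dtw_p v w * hprod v v = tw_p v * (dtw_p v w + dtw_q v w) &
       dtw_q v w * hprod v v = tw_q v * (dtw_p v w + dtw_q v w)].
Proof.
move=> /Re_hprodvv_neq0 v0 vw.
have der (F : 'rV[C]_4 -> R) a b c k :
    (forall u, twistor u 0 k = F u / complex.Re (hprod u u)) ->
    (forall s : R, F (v + s%:C *: w) = a + s * b + s ^+ 2 * c) ->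
  b * complex.Re (hprod v v) = a * complex.Re (dtw_p v w + dtw_q v w).
  move=> kE FE.
  apply: (@is_derive0_quadratic_quotient _ _ c _ _ (complex.Re (hprod w w)) _ v0)
    (vw k) => s.
  rewrite kE FE; congr (_ / _); have [_ _ PE QE] := tw_line v w s.
  rewrite !hprodvvE PE QE.
  rewrite (_ : _ + _ = tw_p v + tw_q v + (dtw_p v w + dtw_q v w) * s%:C +
    (tw_p w + tw_q w) * (s ^+ 2)%:C); last by ring.
  exact: Re_quadratic.
have cplx (z t : C) : dtw_p v w + dtw_q v w = (dtw_p v w + dtw_q v w)^* ->
    complex.Re z * complex.Re (hprod v v) =
      complex.Re t * complex.Re (dtw_p v w + dtw_q v w) ->
    complex.Im z * complex.Re (hprod v v) =
      complex.Im t * complex.Re (dtw_p v w + dtw_q v w) ->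
  z * hprod v v = t * (dtw_p v w + dtw_q v w).
  move=> /esym/CrealP N'real zt zt'; rewrite -hprodvv_real -(RRe_real N'real).
  by apply: eqC_ReIm; rewrite ?Re_mul_real ?Im_mul_real.
have N'real : dtw_p v w + dtw_q v w = (dtw_p v w + dtw_q v w)^*.
  by rewrite /dtw_p /dtw_q !conjC_E; ring.
have two0 : 2 != 0 :> C by rewrite pnatr_eq0.
have difE : (dtw_p v w - dtw_q v w) * hprod v v =
    (tw_p v - tw_q v) * (dtw_p v w + dtw_q v w).
  apply: cplx => //.
    apply: (@der (fun u => complex.Re (tw_p u - tw_q u)) _ _
      (complex.Re (tw_p w - tw_q w)) 4) => [u|s]; first by rewrite twistorE mxE.
    have [_ _ -> ->] := tw_line v w s; rewrite -Re_quadratic; congr complex.Re; ring.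
  have Im0 u : complex.Im (tw_p u - tw_q u) = 0 by rewrite -tw_p_real -tw_q_real /= subrr.
  rewrite Im0 mul0r (_ : dtw_p v w - dtw_q v w =
    (complex.Re (dtw_p v w - dtw_q v w))%:C) ?mul0r //.
  symmetry; apply: RRe_real; apply/CrealP; rewrite /dtw_p /dtw_q !conjC_E; ring.
split.
- apply: (mulfI two0); rewrite !mulrA; apply: cplx => //.
    apply: (@der (fun u => complex.Re (2 * tw_a u)) _ _ (complex.Re (2 * tw_a w)) 0)
      => [u|s]; first by rewrite twistorE mxE.
    have [-> _ _ _] := tw_line v w s; rewrite -Re_quadratic; congr complex.Re; ring.
  apply: (@der (fun u => complex.Im (2 * tw_a u)) _ _ (complex.Im (2 * tw_a w)) 1)
    => [u|s]; first by rewrite twistorE mxE.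
  have [-> _ _ _] := tw_line v w s; rewrite -Im_quadratic; congr complex.Im; ring.
- apply: (mulfI two0); rewrite !mulrA; apply: cplx => //.
    apply: (@der (fun u => complex.Re (2 * tw_b u)) _ _ (complex.Re (2 * tw_b w)) 2)
      => [u|s]; first by rewrite twistorE mxE.
    have [_ -> _ _] := tw_line v w s; rewrite -Re_quadratic; congr complex.Re; ring.
  apply: (@der (fun u => complex.Im (2 * tw_b u)) _ _ (complex.Im (2 * tw_b w)) 3)
    => [u|s]; first by rewrite twistorE mxE.
  have [_ -> _ _] := tw_line v w s; rewrite -Im_quadratic; congr complex.Im; ring.
- apply: (mulfI two0).
  rewrite (_ : 2 * _ = (dtw_p v w - dtw_q v w) * hprod v v +
    (dtw_p v w + dtw_q v w) * hprod v v); last by ring.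
  by rewrite difE hprodvvE; ring.
- apply: (mulfI two0).
  rewrite (_ : 2 * _ = (dtw_p v w + dtw_q v w) * hprod v v -
    (dtw_p v w - dtw_q v w) * hprod v v); last by ring.
  by rewrite difE hprodvvE; ring.
Qed.

End TwistorAlgebra.

(** * Horizontality in terms of the symplectic form *)

Section TwistorHorizontal.
Variable R : realType.
Local Notation C := R[i].
Implicit Types u v w : 'rV[C]_4.

(** Differentiating in the direction [w] the tautologies obtained from the
    equations of [in_quat_lineP] when [w = v] gives these equations for [w],
    up to terms that cancel because the derivatives are proportional to the
    values. *)
Lemma vertical_in_quat_line v w : v != 0 -> vertical v w -> in_quat_line v w.
Proof.
move=> v0 vw; have [eA eB eP eQ] := vertical_derivatives v0 vw.
have N0 : hprod v v != 0 by rewrite hprodvv_eq0.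
have N'real : (dtw_p v w + dtw_q v w)^* = dtw_p v w + dtw_q v w.
  by rewrite /dtw_p /dtw_q !conjC_E; ring.
have eAc : (dtw_a v w)^* * hprod v v = (tw_a v)^* * (dtw_p v w + dtw_q v w).
  by rewrite -[in LHS]conj_hprodvv -conjC_M eA conjC_M N'real.
have eBc : (dtw_b v w)^* * hprod v v = (tw_b v)^* * (dtw_p v w + dtw_q v w).
  by rewrite -[in LHS]conj_hprodvv -conjC_M eB conjC_M N'real.
set n := hprod v v in N0 eA eB eP eQ eAc eBc.
set n' := dtw_p v w + _ in eA eB eP eQ eAc eBc.
have red (x y z t : C) : (x - y) * n = z - t -> z = t -> x = y.
  by move=> e zt; apply/eqP; rewrite -subr_eq0 -(mulIr_eq0 _ (mulIf N0)) e zt subrr.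
apply: in_quat_lineP.
- apply: (red _ _ (v 0 2 * ((dtw_a v w)^* * n) + v 0 3 * ((dtw_b v w)^* * n))
    (v 0 0 * (dtw_q v w * n))).
    by rewrite /tw_a /dtw_a /tw_b /dtw_b /tw_q /dtw_q !conjC_E; ring.
  by rewrite eAc eBc eQ /tw_a /tw_b /tw_q !conjC_E; ring.
- apply: (red _ _ (v 0 3 * (dtw_a v w * n) - v 0 2 * (dtw_b v w * n))
    (v 0 1 * (dtw_q v w * n))).
    by rewrite /tw_a /dtw_a /tw_b /dtw_b /tw_q /dtw_q; ring.
  by rewrite eA eB eQ /tw_a /tw_b /tw_q; ring.
- apply: (red _ _ (v 0 0 * (dtw_a v w * n) - v 0 1 * ((dtw_b v w)^* * n))
    (v 0 2 * (dtw_p v w * n))).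
    by rewrite /tw_a /dtw_a /tw_b /dtw_b /tw_p /dtw_p !conjC_E; ring.
  by rewrite eA eBc eP /tw_a /tw_b /tw_p !conjC_E; ring.
- apply: (red _ _ (v 0 1 * ((dtw_a v w)^* * n) + v 0 0 * (dtw_b v w * n))
    (v 0 3 * (dtw_p v w * n))).
    by rewrite /tw_a /dtw_a /tw_b /dtw_b /tw_p /dtw_p !conjC_E; ring.
  by rewrite eAc eB eP /tw_a /tw_b /tw_p !conjC_E; ring.
Qed.

Lemma hprodC u w : hprod w u = (hprod u w)^*.
Proof. by rewrite !hprodE !conjC_E; ring. Qed.

Lemma hprodDl u u' w : hprod (u + u') w = hprod u w + hprod u' w.
Proof. by rewrite !hprodE !mxE; ring. Qed.

Lemma hprodZl c u w : hprod (c *: u) w = c * hprod u w.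
Proof. by rewrite !hprodE !mxE; ring. Qed.

Lemma hprodZr c u w : hprod u (c *: w) = c^* * hprod u w.
Proof. by rewrite hprodC hprodZl conjC_M -hprodC. Qed.

Lemma omegavv v : omega v v = 0.
Proof. by rewrite /omega; ring. Qed.

(** The real line through [v] in the direction [quat_j v] stays in the fibre. *)
Lemma vertical_quat_j v : v != 0 -> vertical v (quat_j v).
Proof.
move=> v0 k; rewrite (_ : (fun s => _) = cst (twistor v 0 k)).
  exact: is_derive_cst.
apply/funext => s /=; have -> : v + s%:C *: quat_j v = 1 *: v + s%:C *: quat_j v.
  by rewrite scale1r.
rewrite twistor_fiber// scale1r; apply: contraNneq v0 => /(congr1 (fun u => hprod u v)).
rewrite hprodDl hprodZl (hprodC v (quat_j v)) hprod_quat_j omegavv conjC0 mulr0 addr0.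
rewrite [X in _ = X](_ : _ = 0); first by move/eqP; rewrite hprodvv_eq0.
by rewrite hprodE !mxE; ring.
Qed.

(** The vertical directions are the quaternionic line of [v], and modulo [v] this
    is the line of [quat_j v], on which the Hermitian product with [u] is
    [omega v u]. *)
Lemma horizontal_atP v u : v != 0 -> horizontal_at v u <-> omega v u = 0.
Proof.
move=> v0; have N0 : hprod v v != 0 by rewrite hprodvv_eq0.
split=> [hor|uv0 c w /(vertical_in_quat_line v0) line].
  have := hor (omega v u)^* _ (vertical_quat_j v0).
  rewrite /fubini_study !hprodZl !hprod_quat_j omegavv mulr0 subr0.
  rewrite expr2 invfM mulrA mulfK//.
  have -> : (hprod v v)^-1 = ((complex.Re (hprod v v))^-1)%:C.
    rewrite -[in LHS]hprodvv_real; apply: esym; exact: fmorphV.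
  rewrite Re_mul_real.
  move=> /eqP; rewrite mulf_eq0 invr_eq0 (negbTE (Re_hprodvv_neq0 v0)) orbF.
  rewrite mulrC -normCK => /eqP e; apply/eqP; rewrite -normr_eq0 -sqrf_eq0.
  by rewrite -[_ ^+ 2]RRe_real ?e// rpredX// normr_real.
have uw : hprod u w * hprod v v = hprod u v * hprod v w.
  have := congr1 (hprod u) line.
  rewrite hprodZr conj_hprodvv (hprodC (_ + _)) hprodDl hprodZl hprodZl conjC_D !conjC_M.
  rewrite -!hprodC hprod_quat_j uv0 mulr0 addr0 => e.
  by rewrite mulrC e mulrC.
by rewrite /fubini_study !hprodZl -!mulrA uw subrr mul0r.
Qed.

End TwistorHorizontal.

(** * Cubic curves and their coefficient vectors *)

(** Otherwise the polynomial would have more roots than its degree. *)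
Lemma poly_eq0_real (R : realType) (p : {poly R[i]}) :
  (forall r : R, p.[r%:C] = 0) -> p = 0.
Proof.
move=> p0; apply/eqP; apply: contraT => pn0.
have := @max_poly_roots _ p [seq (n%:R : R)%:C | n <- iota 0 (size p)] pn0.
rewrite size_map size_iota ltnn; apply.
- by apply/allP => _ /mapP[n _ ->]; apply/rootP.
- by rewrite map_inj_uniq ?iota_uniq// => m n /complexI /eqP; rewrite eqr_nat => /eqP.
Qed.

Section Cubics.
Variable R : realType.
Local Notation C := R[i].
Implicit Types (A : 'M[C]_(4, 4)) (u v w : 'rV[C]_4).

Definition coefv A k : 'rV[C]_4 := (col k A)^T.

Lemma coefvE A k i : coefv A k 0 i = A i k.
Proof. by rewrite !mxE. Qed.

Lemma coef_coord_poly A i (k : 'I_4) : (@coord_poly R 3 A i)`_k = A i k.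
Proof. by rewrite coef_rVpoly_ord mxE. Qed.

Lemma size_coord_poly A i : (size (@coord_poly R 3 A i) <= 4)%N.
Proof. exact: size_poly. Qed.

Lemma hliftE A z : @hlift R 3 A z =
  coefv A 0 + z *: coefv A 1 + z ^+ 2 *: coefv A 2 + z ^+ 3 *: coefv A 3.
Proof.
apply/rowP => i; rewrite mxE (horner_coef_wide _ (size_coord_poly A i)).
by rewrite sum_ord4 !coef_coord_poly !mxE expr0 expr1; ring.
Qed.

Lemma dhliftE A z : @dhlift R 3 A z =
  coefv A 1 + (2 * z) *: coefv A 2 + (3 * z ^+ 2) *: coefv A 3.
Proof.
apply/rowP => i; rewrite mxE.
have szd : (size (@coord_poly R 3 A i)^`() <= 4)%N.
  apply: leq_trans (size_poly _ _) _; apply: leq_trans (leq_pred _) _.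
  exact: size_coord_poly.
rewrite (horner_coef_wide _ szd) sum_ord4 !coef_deriv.
have -> : (@coord_poly R 3 A i)`_4 = 0 by rewrite nth_default ?size_coord_poly.
rewrite (coef_coord_poly A i 1) (coef_coord_poly A i 2) (coef_coord_poly A i 3).
rewrite !mxE -[nat_of_ord 0]/0%N -[nat_of_ord 1]/1%N -[nat_of_ord 2]/2%N.
by rewrite -[nat_of_ord 3]/3%N expr0 expr1 mul0rn; ring.
Qed.

Lemma coefv_chart_oo A k : coefv (@chart_oo R 3 A) k = coefv A (rev_ord k).
Proof. by apply/rowP => i; rewrite !mxE. Qed.

Lemma hlift0 A : @hlift R 3 A 0 = coefv A 0.
Proof. by rewrite hliftE !expr0n /= !scale0r !addr0. Qed.

Lemma dhlift0 A : @dhlift R 3 A 0 = coefv A 1.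
Proof. by rewrite dhliftE !expr0n /= !mulr0 !scale0r !addr0. Qed.

Lemma curve_oo A : @curve R 3 A None = coefv A 3.
Proof.
by rewrite /curve hlift0 coefv_chart_oo; congr coefv; apply: val_inj.
Qed.

Lemma quartic_eq0 (c0 c1 c2 c3 c4 : C) :
  (forall z, c0 + z * c1 + z ^+ 2 * c2 + z ^+ 3 * c3 + z ^+ 4 * c4 = 0) ->
  [/\ c0 = 0, c1 = 0, c2 = 0, c3 = 0 & c4 = 0].
Proof.
move=> c; have p0 : Poly [:: c0; c1; c2; c3; c4] = 0.
  apply: poly_eq0_real => r; rewrite horner_Poly /= -[RHS](c r%:C); ring.
have cE k : [:: c0; c1; c2; c3; c4]`_k = 0 by rewrite -coef_Poly p0 coef0.
split; [exact: (cE 0%N)|exact: (cE 1%N)|exact: (cE 2%N)|exact: (cE 3%N)|].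
exact: (cE 4%N).
Qed.

Lemma coefv_mul A (h : 'cV[C]_4) k : (coefv A k *m h) 0 0 = (h^T *m A) 0 k.
Proof. by rewrite !mxE; apply: eq_bigr => i _; rewrite !mxE mulrC. Qed.

(** A linear relation between the four components is a vector of the left kernel of
    the matrix, since the values of a nonzero polynomial are not all zero. *)
Lemma linearly_full_unit A : @linearly_full R 3 A <-> A \in unitmx.
Proof.
split=> [full|Au h h0].
  rewrite unitmxE unitfE; apply/negP => /det0P[v v0 vA].
  have [|p] := full v^T; first by rewrite trmx_eq0.
  have coefv0 k : coefv A k *m v^T = 0.
    by apply/rowP => i; rewrite ord1 coefv_mul trmxK vA !mxE.
  case/negP; case: p => [z|]; last by rewrite curve_oo coefv0.
  by rewrite /= hliftE !mulmxDl -!scalemxAl !coefv0 !scaler0 !addr0.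
apply: contrapT => /forallNP hp.
have hp0 p : @curve R 3 A p *m h = 0.
  by apply/eqP; rewrite -[_ == _]negbK; apply/negP; apply: hp.
have /quartic_eq0[h0' h1 h2 h3 _] z : (h^T *m A) 0 0 + z * (h^T *m A) 0 1 +
    z ^+ 2 * (h^T *m A) 0 2 + z ^+ 3 * (h^T *m A) 0 3 + z ^+ 4 * 0 = 0.
  rewrite mulr0 addr0 -!coefv_mul.
  have -> : 0 = (0 : 'M[C]_1) 0 0 :> C by rewrite mxE.
  rewrite -(hp0 (Some z)) /= hliftE.
  have entry (M0 M1 M2 M3 : 'M[C]_1) : M0 0 0 + z * M1 0 0 + z ^+ 2 * M2 0 0 +
      z ^+ 3 * M3 0 0 = (M0 + z *: M1 + z ^+ 2 *: M2 + z ^+ 3 *: M3) 0 0.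
    by rewrite !mxE.
  by rewrite entry !mulmxDl -!scalemxAl.
have : h^T *m A = 0.
  by apply/rowP; apply: forall_ord4; rewrite [RHS]mxE.
move=> /(congr1 (mulmx^~ (invmx A))); rewrite mulmxK// mul0mx => /eqP.
by rewrite trmx_eq0 (negbTE h0).
Qed.

End Cubics.

(** * Horizontal cubics *)

Section Legendrian.
Variable R : realType.
Local Notation C := R[i].
Implicit Types (A : 'M[C]_(4, 4)) (u v w : 'rV[C]_4).

Lemma hlift_coord A z i : @hlift R 3 A z 0 i =
  A i 0 + z * A i 1 + z ^+ 2 * A i 2 + z ^+ 3 * A i 3.
Proof. by rewrite hliftE !mxE. Qed.

Lemma dhlift_coord A z i : @dhlift R 3 A z 0 i =
  A i 1 + 2 * z * A i 2 + 3 * z ^+ 2 * A i 3.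
Proof. by rewrite dhliftE !mxE. Qed.

Lemma hlift_neq0 A z : A \in unitmx -> @hlift R 3 A z != 0.
Proof.
move=> Au; apply/negP => /eqP f0.
have : A *m \col_k (z ^+ k) = 0.
  apply/colP => i; move/rowP/(_ i): f0; rewrite hlift_coord 2!mxE => f0.
  by rewrite mxE sum_ord4 !mxE -[RHS]f0 expr0 expr1; ring.
move=> /(congr1 (mulmx (invmx A))); rewrite mulKmx// mulmx0 => /colP/(_ 0)/eqP.
by rewrite !mxE expr0 oner_eq0.
Qed.

Lemma coefv_neq0 A k : A \in unitmx -> coefv A k != 0.
Proof.
move=> Au; apply/negP => /eqP a0.
have : A *m delta_mx k (0 : 'I_1) = 0.
  by rewrite -colE -[col k A]trmxK -/(coefv A k) a0 trmx0.
move=> /(congr1 (mulmx (invmx A))); rewrite mulKmx// mulmx0 => /colP/(_ k)/eqP.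
by rewrite !mxE !eqxx oner_eq0.
Qed.

Lemma curve_neq0 A p : A \in unitmx -> @curve R 3 A p != 0.
Proof.
by case: p => [z|] Au; [exact: hlift_neq0|rewrite curve_oo coefv_neq0].
Qed.

Lemma has_degree_unit A : A \in unitmx -> @has_degree R 3 A.
Proof.
move=> Au; split=> [z|].
  apply: contrapT => /forallNP f0; have /eqP[] := hlift_neq0 z Au.
  by apply/rowP => i; have := f0 i; rewrite !mxE => /negP; rewrite negbK => /eqP.
apply/eqP; rewrite eqn_leq; apply/andP; split.
  by apply/bigmax_leqP => i _; exact: size_coord_poly.
have /rV0Pn[i ai0] := coefv_neq0 3 Au.
apply: leq_trans (leq_bigmax i); rewrite ltnNge; apply/negP => sz.
by move: ai0; rewrite coefvE -coef_coord_poly nth_default ?eqxx.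
Qed.

(** The coefficients of the polynomial [omega (f z) (f' z)], up to nonzero
    integers. For an invertible [A], they say that the symplectic form has
    only the entries (0, 3) and (1, 2) in the basis of the columns of [A], and
    that the ratio of these entries is that of the twisted cubic. *)
Definition legendrian A : Prop :=
  [/\ omega (coefv A 0) (coefv A 1) = 0, omega (coefv A 0) (coefv A 2) = 0,
      omega (coefv A 1) (coefv A 2) + 3 * omega (coefv A 0) (coefv A 3) = 0,
      omega (coefv A 1) (coefv A 3) = 0 & omega (coefv A 2) (coefv A 3) = 0].

Lemma omega_hlift A z : omega (@hlift R 3 A z) (@dhlift R 3 A z) =
  omega (coefv A 0) (coefv A 1) + z * (2 * omega (coefv A 0) (coefv A 2)) +
  z ^+ 2 * (omega (coefv A 1) (coefv A 2) + 3 * omega (coefv A 0) (coefv A 3)) +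
  z ^+ 3 * (2 * omega (coefv A 1) (coefv A 3)) +
  z ^+ 4 * omega (coefv A 2) (coefv A 3).
Proof. rewrite /omega !hlift_coord !dhlift_coord !coefvE; ring. Qed.

Lemma horizontal_unit A : A \in unitmx -> @horizontal R 3 A <-> legendrian A.
Proof.
move=> Au; have two0 : 2 != 0 :> C by rewrite pnatr_eq0.
split=> [[hor _]|[w01 w02 w12 w13 w23]].
  have /quartic_eq0[w01 w02 w12 w13 w23] z := etrans (esym (omega_hlift A z))
    ((horizontal_atP _ (hlift_neq0 z Au)).1 (hor z)).
  by split=> //; apply: (mulfI two0); rewrite mulr0.
have oo0 : @hlift R 3 (@chart_oo R 3 A) 0 != 0 by exact: (curve_neq0 None Au).
split=> [z|].
  apply/horizontal_atP; first exact: hlift_neq0.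
  by rewrite omega_hlift w01 w02 w12 w13 w23 !mulr0 !addr0.
apply/horizontal_atP => //; rewrite hlift0 dhlift0 !coefv_chart_oo.
have -> : rev_ord (0 : 'I_4) = 3 by apply: val_inj.
have -> : rev_ord (1 : 'I_4) = 2 by apply: val_inj.
by rewrite -[RHS]oppr0 -[in RHS]w23 /omega; ring.
Qed.

End Legendrian.

(** * The antipodal transform of a cubic *)

(** A polynomial in [z] and its conjugate that vanishes everywhere is zero. It is
    a polynomial in the real and imaginary parts [x] and [y] of [z], so it
    still vanishes when [x] and [y] are replaced by complex numbers, and then
    [x + i y] and [x - i y] are independent variables. *)
Lemma polarization (R : realType) (S : 'I_4 -> {poly R[i]}) :
  (forall z : R[i], \sum_j (S j).[z] * z^* ^+ j = 0) -> forall j, S j = 0.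
Proof.
move=> S0.
have Sxy (x y : R[i]) : \sum_j (S j).[x + 'i * y] * (x - 'i * y) ^+ j = 0.
  pose P (t : R[i]) := \sum_j (S j \Po ('X + ('i * t)%:P)) * ('X - ('i * t)%:P) ^+ j.
  pose Q (t : R[i]) := \sum_j (S j \Po (t%:P + 'i *: 'X)) * (t%:P - 'i *: 'X) ^+ j.
  have PE t s : (P t).[s] = \sum_j (S j).[s + 'i * t] * (s - 'i * t) ^+ j.
    by rewrite /P horner_sum; apply: eq_bigr => j _; rewrite !(hornerE, horner_comp).
  have QE t s : (Q t).[s] = \sum_j (S j).[t + 'i * s] * (t - 'i * s) ^+ j.
    by rewrite /Q horner_sum; apply: eq_bigr => j _; rewrite !(hornerE, horner_comp).
  rewrite -QE (_ : Q x = 0) ?horner0//; apply: poly_eq0_real => t.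
  rewrite QE -PE (_ : P t%:C = 0) ?horner0//; apply: poly_eq0_real => s.
  rewrite PE -[RHS](S0 (s%:C + 'i * t%:C)); apply: eq_bigr => j _.
  by rewrite !conjC_E conjCi mulNr.
have two0 : 2 != 0 :> R[i] by rewrite pnatr_eq0.
have i0 : 'i != 0 :> R[i] by rewrite neq0Ci.
have Szw (p q : R[i]) : \sum_j (S j).[p] * q ^+ j = 0.
  rewrite -[RHS](Sxy ((p + q) / 2) ((p - q) / (2 * 'i))).
  have -> : 'i * ((p - q) / (2 * 'i)) = (p - q) / 2 by field; rewrite i0.
  by apply: eq_bigr => j _; congr ((S j).[_] * _ ^+ j); field.
have Sz (p : R[i]) j : (S j).[p] = 0.
  have [] := @quartic_eq0 R (S 0).[p] (S 1).[p] (S 2).[p] (S 3).[p] 0.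
    move=> w; rewrite -[RHS](Szw p w) sum_ord4.
    rewrite -[nat_of_ord 0]/0%N -[nat_of_ord 1]/1%N.
    by rewrite -[nat_of_ord 2]/2%N -[nat_of_ord 3]/3%N; ring.
  by move=> S0p S1p S2p S3p _; move: j; exact: forall_ord4.
by move=> j; apply: poly_eq0_real => r.
Qed.

Section Antipodal.
Variable R : realType.
Local Notation C := R[i].
Implicit Types (A : 'M[C]_(4, 4)) (u v w : 'rV[C]_4).

Lemma conjC_V (x : C) : (x^-1)^* = (x^*)^-1. Proof. exact: fmorphV. Qed.
Lemma conjC_X (x : C) n : (x ^+ n)^* = x^* ^+ n. Proof. exact: rmorphXn. Qed.

Lemma twistorZ c v : c != 0 -> v != 0 -> twistor (c *: v) = twistor v.
Proof.
move=> c0 v0; have cv0 : c *: v + 0 *: quat_j v != 0.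
  by rewrite scale0r addr0 scaler_eq0 negb_or c0.
by rewrite -(twistor_fiber cv0) scale0r addr0.
Qed.

Lemma quat_jD u v : quat_j (u + v) = quat_j u + quat_j v.
Proof.
apply/rowP; apply: forall_ord4; rewrite [RHS]mxE !quat_jE mxE conjC_D//;
  exact: opprD.
Qed.

Lemma quat_jZ c v : quat_j (c *: v) = c^* *: quat_j v.
Proof.
apply/rowP; apply: forall_ord4; rewrite [RHS]mxE !quat_jE mxE conjC_M//;
  by rewrite mulrN.
Qed.

Lemma quat_j_eq0 v : (quat_j v == 0) = (v == 0).
Proof.
have j0 : quat_j (0 : 'rV[C]_4) = 0.
  by apply/rowP; apply: forall_ord4; rewrite quat_jE !mxE conjC0 ?oppr0.
apply/eqP/eqP => [jv|->//]; apply: oppr_inj.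
by rewrite -quat_jK jv j0 oppr0.
Qed.

Lemma twistor_quat_j v : v != 0 -> twistor (quat_j v) = twistor v.
Proof.
move=> v0; have cv0 : 0 *: v + 1 *: quat_j v != 0.
  by rewrite scale0r add0r scale1r quat_j_eq0.
by rewrite -(twistor_fiber cv0) scale0r add0r scale1r.
Qed.

(** The curve obtained from [f] by applying [quat_j] to its values and composing
    with the antipode. It is again a cubic curve, because both maps are
    antiholomorphic: [z^3 quat_j (f (- 1 / z^* ))] is a polynomial in [z]. *)
Definition antipodal_mx A : 'M[C]_(4, 4) := \matrix_(i, k)
  ([:: - quat_j (coefv A 3); quat_j (coefv A 2);
       - quat_j (coefv A 1); quat_j (coefv A 0)]`_k) 0 i.

Lemma antipodal_mxE A : ((coefv (antipodal_mx A) 0 = - quat_j (coefv A 3)) *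
  (coefv (antipodal_mx A) 1 = quat_j (coefv A 2)) *
  (coefv (antipodal_mx A) 2 = - quat_j (coefv A 1)) *
  (coefv (antipodal_mx A) 3 = quat_j (coefv A 0)))%type.
Proof.
split; [split; [split|]|]; apply/rowP => i; rewrite coefvE mxE //.
Qed.

Lemma hlift_antipodal_mx A z : exists2 c, c != 0 &
  @hlift R 3 (antipodal_mx A) z = c *: quat_j (@curve R 3 A (antipode (Some z))).
Proof.
have [->|z0] := eqVneq z 0.
  exists (-1); first by rewrite oppr_eq0 oner_eq0.
  by rewrite hlift0 antipodal_mxE /antipode eqxx curve_oo scaleN1r.
exists (z ^+ 3); first exact: expf_neq0.
rewrite /antipode (negbTE z0) hliftE !antipodal_mxE /curve hliftE.
set t := - (z^*)^-1; have tc : t^* = - z^-1 by rewrite /t conjC_N conjC_V conjCK.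
rewrite !quat_jD !quat_jZ !conjC_X !tc.
by apply/rowP => i; rewrite !(mxE _ _ 0 i); field.
Qed.

End Antipodal.

(** * Polarizing the invariance under the antipode *)

Section AntipodalSymmetry.
Variable R : realType.
Local Notation C := R[i].
Implicit Types (A : 'M[C]_(4, 4)) (u v w : 'rV[C]_4).

Lemma hlift_antipodal_neq0 A z : A \in unitmx -> @hlift R 3 (antipodal_mx A) z != 0.
Proof.
move=> Au; have [c c0 ->] := hlift_antipodal_mx A z.
by rewrite scaler_eq0 quat_j_eq0 negb_or c0 curve_neq0.
Qed.

Lemma twistor_antipodal_mx A z : A \in unitmx ->
  twistor (@hlift R 3 (antipodal_mx A) z) = twistor_curve A (antipode (Some z)).
Proof.
move=> Au; have [c c0 ->] := hlift_antipodal_mx A z.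
by rewrite twistorZ ?quat_j_eq0 ?twistor_quat_j ?curve_neq0.
Qed.

Lemma hprodDr u v w : hprod u (v + w) = hprod u v + hprod u w.
Proof. by rewrite ![hprod u _]hprodC hprodDl conjC_D. Qed.

Lemma hprod_hlift A u z :
  hprod u (@hlift R 3 A z) = \sum_j hprod u (coefv A j) * z^* ^+ j.
Proof.
rewrite hliftE !hprodDr !hprodZr !conjC_X sum_ord4.
rewrite -[nat_of_ord 0]/0%N -[nat_of_ord 1]/1%N.
by rewrite -[nat_of_ord 2]/2%N -[nat_of_ord 3]/3%N; ring.
Qed.

Lemma quat_j_hlift A z i : quat_j (@hlift R 3 A z) 0 i =
  \sum_j quat_j (coefv A j) 0 i * z^* ^+ j.
Proof.
rewrite hliftE !quat_jD !quat_jZ !conjC_X sum_ord4 !(mxE _ _ 0 i).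
rewrite -[nat_of_ord 0]/0%N -[nat_of_ord 1]/1%N.
by rewrite -[nat_of_ord 2]/2%N -[nat_of_ord 3]/3%N; ring.
Qed.

(** If the harmonic map is invariant, [w] is in the quaternionic line of [v] for
    all [z]. This is a polynomial identity in [z] and its conjugate, the
    conjugate occurring only in the conjugates of [v], which are linear
    combinations of those of the coefficient vectors. By polarization,
    the latter can be put in place of the conjugate of [v]. *)
Lemma antipodal_wedge_polarized A z j k : A \in unitmx ->
    antipodal_invariant (twistor_curve A) ->
    let v := @hlift R 3 A z in let w := @hlift R 3 (antipodal_mx A) z in
  hprod v (coefv A j) * w 0 k - hprod w (coefv A j) * v 0 k
  - omega v w * quat_j (coefv A j) 0 k = 0.
Proof.
move=> Au inv.
pose F := @coord_poly R 3 A; pose G := @coord_poly R 3 (antipodal_mx A).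
pose hp (H : 'I_4 -> {poly C}) j : {poly C} := \sum_i (A i j)^* *: H i.
pose S j := hp F j * G k - hp G j * F k -
  (quat_j (coefv A j) 0 k) *: (F 0 * G 1 - F 1 * G 0 + F 2 * G 3 - F 3 * G 2).
have hpF t i : (hp F i).[t] = hprod (@hlift R 3 A t) (coefv A i).
  rewrite horner_sum; apply: eq_bigr => l _; rewrite hornerZ mulrC; congr (_ * _).
    by rewrite mxE.
  by rewrite coefvE.
have hpG t i : (hp G i).[t] = hprod (@hlift R 3 (antipodal_mx A) t) (coefv A i).
  rewrite horner_sum; apply: eq_bigr => l _; rewrite hornerZ mulrC; congr (_ * _).
    by rewrite mxE.
  by rewrite coefvE.
have SE t i : (S i).[t] = let v := @hlift R 3 A t in
    let w := @hlift R 3 (antipodal_mx A) t in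
    hprod v (coefv A i) * w 0 k - hprod w (coefv A i) * v 0 k
    - omega v w * quat_j (coefv A i) 0 k.
  rewrite /S !(hornerD, hornerN, hornerM, hornerZ) hpF hpG /= /omega.
  by rewrite [X in _ - X]mulrC !(mxE _ _ 0 _).
rewrite /= -[LHS](SE z j) (_ : S j = 0) ?horner0//; apply: polarization => t.
set v := @hlift R 3 A t; set w := @hlift R 3 (antipodal_mx A) t.
have /rowP/(_ k) : in_quat_line v w.
  apply: twistor_eq_in_quat_line.
  - exact: hlift_neq0.
  - exact: hlift_antipodal_neq0.
  - by rewrite /w twistor_antipodal_mx// inv.
rewrite [LHS]mxE [RHS]mxE [X in X + _]mxE [X in _ + X]mxE hprod_quat_j => e.
transitivity (hprod v v * w 0 k - hprod w v * v 0 k - omega v w * quat_j v 0 k).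
  have hv u : hprod u v = \sum_j hprod u (coefv A j) * t^* ^+ j := hprod_hlift A u t.
  have jv : quat_j v 0 k = _ := quat_j_hlift A t k.
  rewrite !hv jv !mulr_suml mulr_sumr.
  rewrite -!sumrB; apply: eq_bigr => i _; rewrite SE -/v -/w /=; ring.
by rewrite e; ring.
Qed.

End AntipodalSymmetry.

(** * Invariant cubics are fixed by the antipodal transform *)

Section AntipodalProportional.
Variable R : realType.
Local Notation C := R[i].
Implicit Types (A : 'M[C]_(4, 4)) (u v w : 'rV[C]_4).

Lemma coefv_span A u : A \in unitmx -> exists x : 'I_4 -> C,
  u = x 0 *: coefv A 0 + x 1 *: coefv A 1 + x 2 *: coefv A 2 + x 3 *: coefv A 3.
Proof.
move=> Au; exists (fun k => (invmx A *m u^T) k 0); apply/rowP => i.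
have /colP/(_ i) := mulKVmx Au u^T; rewrite [RHS]mxE => <-.
by move: (invmx A *m u^T) => y; rewrite !mxE sum_ord4 !(mulrC (A i _)).
Qed.

(** Since the coefficient vectors span C^4, any vector can be put in their
    place in the polarized identity. The vectors of the standard basis give
    [v /\ w = omega v w * J], with [J] the matrix of the symplectic form;
    evaluating the form on both sides gives [omega v w = 2 omega v w], hence
    [v /\ w = 0]. *)
Lemma antipodal_wedge A z i k : A \in unitmx ->
    antipodal_invariant (twistor_curve A) ->
  @hlift R 3 A z 0 i * @hlift R 3 (antipodal_mx A) z 0 k =
  @hlift R 3 (antipodal_mx A) z 0 i * @hlift R 3 A z 0 k.
Proof.
move=> Au inv; have pol j l := antipodal_wedge_polarized z j l Au inv.
move: pol; rewrite /=.
set v := @hlift R 3 A z; set w := @hlift R 3 (antipodal_mx A) z => pol; clearbody v w.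
have full u l : hprod v u * w 0 l - hprod w u * v 0 l - omega v w * quat_j u 0 l = 0.
  pose E u := hprod v u * w 0 l - hprod w u * v 0 l - omega v w * quat_j u 0 l.
  have ED u1 u2 : E (u1 + u2) = E u1 + E u2.
    by rewrite /E !hprodDr quat_jD [(quat_j u1 + _) 0 l]mxE; ring.
  have EZ c u1 : E (c *: u1) = c^* * E u1.
    by rewrite /E !hprodZr quat_jZ [(_ *: quat_j u1) 0 l]mxE; ring.
  have E0 j : E (coefv A j) = 0 by exact: pol.
  rewrite -/(E u); have [x ->] := coefv_span u Au.
  by rewrite !ED !EZ !E0 !mulr0 !addr0.
have delta u l : hprod u (delta_mx 0 l) = u 0 l.
  rewrite /hprod (bigD1 l)//= big1 ?mxE ?eqxx ?conjC1 ?mulr1 ?addr0// => j jl.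
  by rewrite mxE eqxx (negbTE jl) conjC0 mulr0.
(* The entries (0, 1) and (2, 3) of [v /\ w], whose sum is [omega v w]. *)
have vw0 : omega v w = 0.
  have := full (delta_mx 0 0) 1; have := full (delta_mx 0 2) 3.
  rewrite !delta !quat_jE !mxE !eqxx conjC1 !mulr1 => e1 e2.
  transitivity (- ((v 0 0 * w 0 1 - w 0 0 * v 0 1 - omega v w) +
    (v 0 2 * w 0 3 - w 0 2 * v 0 3 - omega v w))); first by rewrite /omega; ring.
  by rewrite e1 e2 addr0 oppr0.
have := full (delta_mx 0 i) k.
by rewrite !delta vw0 mul0r subr0 => /eqP; rewrite subr_eq0 => /eqP.
Qed.

(** The last component of a cubic curve proportional to [(1, z, z^2, z^3)] is
    [z^3] times the first one, so that the first one is constant. *)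
Lemma proportional_to_moment_curve (N : 'M[C]_(4, 4)) :
  (forall z k, @hlift R 3 N z 0 k = @hlift R 3 N z 0 0 * z ^+ k) ->
  N = (N 0 0)%:M.
Proof.
move=> prop; pose p := @coord_poly R 3 N.
have pE k : p k = p 0 * 'X^k.
  apply/eqP; rewrite -subr_eq0; apply/eqP/poly_eq0_real => r.
  by have := prop r%:C k; rewrite !mxE !hornerE => ->; rewrite subrr.
have p0 j : (p 0)`_j.+1 = 0.
  have := coefMXn 3 (p 0) (3 + j.+1); rewrite -(pE 3) ltnNge leq_addr/= addKn => <-.
  by rewrite nth_default// (leq_trans (size_coord_poly _ _))// addnS ltnS leq_addr.
apply/matrixP => k j; rewrite -coef_coord_poly -/(p k) pE coefMXn mxE.
case: ltngtP => [jk|kj|/val_inj <-].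
- by rewrite -val_eqE /= gtn_eqF.
- by rewrite -val_eqE /= ltn_eqF// -(subnSK kj) p0.
- by rewrite subnn eqxx /p -(coef_coord_poly N 0 0).
Qed.

Lemma hlift_mulmx (M : 'M[C]_4) A z :
  @hlift R 3 (M *m A) z = @hlift R 3 A z *m M^T.
Proof.
apply/rowP => i; rewrite [RHS]mxE sum_ord4 !hlift_coord !mxE !sum_ord4.
ring.
Qed.

Lemma mulmx_wedge u v (M : 'M[C]_4) k l :
    (forall i j, u 0 i * v 0 j = v 0 i * u 0 j) ->
  (u *m M) 0 k * (v *m M) 0 l = (v *m M) 0 k * (u *m M) 0 l.
Proof.
move=> uv; rewrite !mxE !big_distrlr; apply: eq_bigr => i _; apply: eq_bigr => j _.
by rewrite /= mulrACA uv mulrACA.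
Qed.

(** A linear change of coordinates of C^4 turns the curve into the moment curve,
    and preserves the proportionality given by [antipodal_wedge]. *)
Lemma antipodal_mx_proportional A : A \in unitmx ->
  antipodal_invariant (twistor_curve A) -> exists c, antipodal_mx A = c *: A.
Proof.
move=> Au inv; pose N := invmx A *m antipodal_mx A.
have NE : N = (N 0 0)%:M.
  apply: proportional_to_moment_curve => z k.
  have h1 l : @hlift R 3 1%:M z 0 l = z ^+ l.
    by move: l; apply: forall_ord4; rewrite hlift_coord !mxE /= ?expr0 ?expr1; ring.
  rewrite -h1 -[LHS]mulr1 -[X in _ * X = _](expr0 z) -[X in _ * X = _](h1 0)
    -(mulVmx Au) !hlift_mulmx.
  rewrite [RHS]mulrC. apply: mulmx_wedge => i j; symmetry.
  exact: antipodal_wedge.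
exists (N 0 0); rewrite -mul_mx_scalar -NE; exact/esym/mulKVmx.
Qed.

Lemma antipodal_invariant_mx A c : A \in unitmx -> antipodal_mx A = c *: A ->
  antipodal_invariant (twistor_curve A).
Proof.
move=> Au AE.
have c0 : c != 0.
  apply: contraTneq Au => c0; move: AE; rewrite c0 scale0r => A0.
  have : quat_j (coefv A 0) = 0.
    by rewrite -(antipodal_mxE A) A0; apply/rowP => i; rewrite coefvE !mxE.
  move/eqP; rewrite quat_j_eq0; apply: contraTN => Au; exact: coefv_neq0.
have fin z : twistor_curve A (antipode (Some z)) = twistor_curve A (Some z).
  rewrite -twistor_antipodal_mx// AE.
  have -> : @hlift R 3 (c *: A) z = c *: @hlift R 3 A z.
    by apply/rowP => i; rewrite [RHS]mxE !hlift_coord !mxE; ring.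
  by rewrite twistorZ ?hlift_neq0.
case=> [z|]; first exact: fin.
by rewrite -(fin 0) /antipode eqxx.
Qed.

End AntipodalProportional.

(** * Normal form of the invariant cubics *)

Section Frames.
Variable R : realType.
Local Notation C := R[i].
Implicit Types (A : 'M[C]_(4, 4)) (a b u v w : 'rV[C]_4).

Definition antipodal_cubic A : Prop :=
  [/\ @has_degree R 3 A, @horizontal R 3 A, @linearly_full R 3 A &
      antipodal_invariant (twistor_curve A)].

(** The curves fixed by [antipodal_mx]: their last two columns are determined by
    the first two. *)
Definition frame_mx a b : 'M[C]_(4, 4) := \matrix_(i, k)
  ([:: a; b; - quat_j b; quat_j a]`_k) 0 i.

(** [a] and [b] are orthogonal over the quaternions. The factor 3 comes from
    the equation [omega a1 a2 + 3 omega a0 a3 = 0] of horizontality. *)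
Definition quat_frame a b : Prop :=
  [/\ a != 0, hprod a b = 0, omega a b = 0 & hprod b b = 3 * hprod a a].

Lemma frame_mxE a b : ((coefv (frame_mx a b) 0 = a) *
  (coefv (frame_mx a b) 1 = b) * (coefv (frame_mx a b) 2 = - quat_j b) *
  (coefv (frame_mx a b) 3 = quat_j a))%type.
Proof. by split; [split; [split|]|]; apply/rowP => i; rewrite coefvE mxE. Qed.

Lemma coefvZ c A k : coefv (c *: A) k = c *: coefv A k.
Proof. by apply/rowP => i; rewrite !mxE. Qed.

Lemma coefv_inj A B : (forall k, coefv A k = coefv B k) -> A = B.
Proof. by move=> AB; apply/matrixP => i k; rewrite -!coefvE AB. Qed.

Lemma orthogonal_unitmx A : (forall k, coefv A k != 0) ->
  (forall k l, k != l -> hprod (coefv A l) (coefv A k) = 0) -> A \in unitmx.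
Proof.
move=> A0 orth.
pose B := \matrix_(k, i) ((A i k)^* / hprod (coefv A k) (coefv A k)).
suff /mulmx1_unit[] : B *m A = 1%:M by [].
apply/matrixP => k l; rewrite !mxE.
transitivity (hprod (coefv A l) (coefv A k) / hprod (coefv A k) (coefv A k)).
  rewrite /hprod mulr_suml; apply: eq_bigr => i _.
  by rewrite !mxE mulrAC (mulrC (A i l)).
have [<-|kl] := eqVneq k l; last by rewrite orth ?mul0r.
by rewrite divff// hprodvv_eq0.
Qed.

Lemma omegaC u v : omega u v = - omega v u.
Proof. by rewrite /omega; ring. Qed.

Lemma omegaNl u v : omega (- u) v = - omega u v.
Proof. by rewrite /omega !mxE; ring. Qed.

Lemma omegaNr u v : omega u (- v) = - omega u v.
Proof. by rewrite /omega !mxE; ring. Qed.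

Lemma omegaZl c u v : omega (c *: u) v = c * omega u v.
Proof. by rewrite /omega !mxE; ring. Qed.

Lemma omegaZr c u v : omega u (c *: v) = c * omega u v.
Proof. by rewrite /omega !mxE; ring. Qed.

Lemma quat_jN v : quat_j (- v) = - quat_j v.
Proof. by rewrite -scaleN1r quat_jZ conjC_N conjC1 scaleN1r. Qed.

Lemma hprod_quat_j2 u v : hprod (quat_j u) (quat_j v) = hprod v u.
Proof. by rewrite hprod_quat_j omega_quat_j. Qed.

Lemma hprodNl u v : hprod (- u) v = - hprod u v.
Proof. by rewrite -scaleN1r hprodZl mulN1r. Qed.

Lemma hprodNr u v : hprod u (- v) = - hprod u v.
Proof. by rewrite hprodC hprodNl conjC_N -hprodC. Qed.

(** The four columns are orthogonal and nonzero. *)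
Lemma frame_unitmx a b : quat_frame a b -> frame_mx a b \in unitmx.
Proof.
case=> a0 ab0 wab bb.
have b0 : b != 0.
  by rewrite -hprodvv_eq0 bb mulf_eq0 pnatr_eq0 /= hprodvv_eq0.
have ba0 : hprod b a = 0 by rewrite hprodC ab0 conjC0.
have wba : omega b a = 0 by rewrite omegaC wab oppr0.
apply: orthogonal_unitmx; first by apply: forall_ord4;
  rewrite frame_mxE ?oppr_eq0 ?quat_j_eq0.
have orth (k l : 'I_4) : (k < l)%N ->
    hprod (coefv (frame_mx a b) k) (coefv (frame_mx a b) l) = 0.
  move: k l; apply: forall_ord4; apply: forall_ord4 => // _;
    rewrite !frame_mxE ?hprodNl ?hprodNr ?hprod_quat_j2 ?hprod_quat_j
      ?omegavv ?wab ?wba ?ab0 ?ba0 ?oppr0 //.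
move=> k l; rewrite neq_lt => /orP[kl|lk]; last exact: orth.
by rewrite hprodC orth// conjC0.
Qed.

Lemma frame_antipodal_cubic k a b : k != 0 -> quat_frame a b ->
  antipodal_cubic (k *: frame_mx a b).
Proof.
move=> k0 fab; have [a0 ab0 wab bb] := fab.
have Au : k *: frame_mx a b \in unitmx.
  by rewrite unitmxZ ?unitfE//; exact: frame_unitmx.
split.
- exact: has_degree_unit.
- apply/horizontal_unit => //; split; rewrite !coefvZ !frame_mxE
    !(omegaZl, omegaZr, omegaNl, omegaNr, omega_quat_j).
  + by rewrite wab !mulr0.
  + by rewrite ab0 oppr0 !mulr0.
  + by rewrite bb; ring.
  + by rewrite hprodC ab0 conjC0 !mulr0.
  + by rewrite hprodC hprod_quat_j omegaC wab oppr0 conjC0 oppr0 !mulr0.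
- exact/linearly_full_unit.
- apply: (@antipodal_invariant_mx _ _ (k^* / k)) => //.
  apply: coefv_inj; apply: forall_ord4;
    rewrite antipodal_mxE !coefvZ !frame_mxE !scalerA divfK//
      !(quat_jZ, quat_jN, quat_jK, scalerN, opprK) //.
Qed.

(** The scalar [c] such that [antipodal_mx A = c *: A] has modulus one because
    [quat_j] squares to [- 1]; multiplying [A] by a suitable scalar [u] turns it
    into 1. Then the columns are as in [frame_mx], and the
    equations of horizontality are those of [quat_frame]. *)
Lemma antipodal_cubic_frame A : antipodal_cubic A ->
  exists k a b, [/\ k != 0, A = k *: frame_mx a b & quat_frame a b].
Proof.
move=> [_ hor /linearly_full_unit Au inv].
have [w01 w02 w12 _ _] := (horizontal_unit Au).1 hor.
have [c Ac] := antipodal_mx_proportional Au inv.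
have a0 := coefv_neq0 0 Au.
have j0 : quat_j (coefv A 0) = c *: coefv A 3.
  by rewrite -coefvZ -Ac antipodal_mxE.
have j1 : quat_j (coefv A 1) = - (c *: coefv A 2).
  by rewrite -coefvZ -Ac antipodal_mxE opprK.
have j3 : quat_j (coefv A 3) = - (c *: coefv A 0).
  by rewrite -coefvZ -Ac antipodal_mxE opprK.
have cc : c^* * c = 1.
  have := congr1 (@quat_j R) j0; rewrite quat_jZ quat_jK j3 scalerN scalerA.
  move=> /oppr_inj/esym/eqP; rewrite -subr_eq0 -[X in _ - X]scale1r -scalerBl.
  by rewrite scaler_eq0 (negbTE a0) orbF subr_eq0 => /eqP.
(* A square root of [c] up to a positive scalar: [1 + c] bisects the angle
   between 1 and [c], except when [c = - 1]. *)
have [u u0 uc] : exists2 u, u != 0 & u^* * c = u.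
  have [c1|c1] := eqVneq (1 + c) 0.
    exists 'i; first exact: neq0Ci.
    rewrite conjCi (_ : c = -1) ?mulrN1 ?opprK//.
    by apply/eqP; rewrite -addr_eq0 addrC c1.
  by exists (1 + c) => //; rewrite conjC_D conjC1 mulrDl mul1r cc addrC.
have c0 : c != 0 by apply: contra_eq_neq cc => ->; rewrite mulr0 eq_sym oner_eq0.
exists u^-1, (u *: coefv A 0), (u *: coefv A 1); split.
- by rewrite invr_eq0.
- apply: coefv_inj; apply: forall_ord4; rewrite coefvZ frame_mxE
    ?quat_jZ ?j0 ?j1 ?scalerN ?opprK !scalerA -?mulrA ?uc mulVf// ?scale1r //.
- have h01 : hprod (coefv A 0) (coefv A 1) = 0.
    by rewrite -omega_quat_j j1 omegaNr omegaZr w02 mulr0 oppr0.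
  have h00 : hprod (coefv A 0) (coefv A 0) = c * omega (coefv A 0) (coefv A 3).
    by rewrite -omega_quat_j j0 omegaZr.
  have h11 : hprod (coefv A 1) (coefv A 1) = - (c * omega (coefv A 1) (coefv A 2)).
    by rewrite -omega_quat_j j1 omegaNr omegaZr.
  split.
  + by rewrite scaler_eq0 negb_or u0.
  + by rewrite hprodZl hprodZr h01 !mulr0.
  + by rewrite omegaZl omegaZr w01 !mulr0.
  + rewrite !hprodZl !hprodZr h11 h00.
    move/eqP: w12; rewrite addr_eq0 => /eqP ->; ring.
Qed.

End Frames.

(** * Limits in the complex plane, and paths avoiding the origin *)

Section ComplexContinuity.
Variable R : realType.
Local Notation C := R[i].

Lemma normC_ge_Re (z : C) : (`|complex.Re z|%:C <= `|z|)%R.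
Proof. exact: normc_ge_Re. Qed.

Lemma continuous_Re : continuous (@complex.Re R : C -> R).
Proof.
move=> z A /nbhs_ballP[e /= e0 eA]; apply/nbhs_ballP.
exists e%:C; first by rewrite /= ltcR.
move=> w /= zw; apply: eA; rewrite /ball /= -ltcR.
have -> : complex.Re z - complex.Re w = complex.Re (z - w).
  by case: z w {zw} => [? ?] [? ?].
exact: le_lt_trans (normC_ge_Re _) zw.
Qed.

Lemma continuous_real_complex : continuous (fun x : R => x%:C : C).
Proof.
move=> x A /nbhs_ballP[e /= e0 eA]; apply/nbhs_ballP.
have eE : (complex.Re e)%:C = e by apply: RRe_real; exact: gtr0_real.
exists (complex.Re e); first by rewrite /= -ltcR eE.
move=> y /= xy; apply: eA; rewrite /ball /= -rmorphB /= -eE.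
by rewrite normc_def /= expr0n /= addr0 sqrtr_sqr ltcR.
Qed.

Lemma continuous_conj : continuous (fun z : C => z^*).
Proof.
move=> z A /nbhs_ballP[e /= e0 eA]; apply/nbhs_ballP; exists e => //.
by move=> w /= zw; apply: eA; rewrite /ball /= -rmorphB norm_conjC.
Qed.

End ComplexContinuity.

Lemma cvg_entries (T : Type) (U : topologicalType) (G : set_system T)
    (FG : Filter G) m n (F : T -> 'M[U]_(m, n)) (M : 'M[U]_(m, n)) :
  (forall i j, F x i j @[x --> G] --> M i j) -> F @ G --> M.
Proof.
move=> FM A [P Pnbhs PA].
have : \forall s \near G, forall i j, P i j (F s i j).
  apply: (@filter_forall _ _ (fun i s => forall j, P i j (F s i j))) => i.
  apply: (@filter_forall _ _ (fun j s => P i j (F s i j))) => j.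
  exact: (FM i j _ (Pnbhs i j)).
by apply: filterS => s PF; apply: PA => i j; exact: PF.
Qed.

Section ComplexLimits.
Variable R : realType.
Local Notation C := R[i].
Variables (T : Type) (G : set_system T).
Context {FG : Filter G}.
Implicit Types (f g : T -> C) (x y : C).

Lemma cvgC_cst x : (x : C) @[t --> G] --> x.
Proof. exact: cvg_cst. Qed.
Arguments cvgC_cst x : clear implicits.

Lemma cvgC_D f g x y : f t @[t --> G] --> x -> g t @[t --> G] --> y ->
  f t + g t @[t --> G] --> x + y.
Proof. exact: cvgD. Qed.

Lemma cvgC_N f x : f t @[t --> G] --> x -> - f t @[t --> G] --> - x.
Proof. exact: cvgN. Qed.

Lemma cvgC_B f g x y : f t @[t --> G] --> x -> g t @[t --> G] --> y ->
  f t - g t @[t --> G] --> x - y.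
Proof. exact: cvgB. Qed.

Lemma cvgC_M f g x y : f t @[t --> G] --> x -> g t @[t --> G] --> y ->
  f t * g t @[t --> G] --> x * y.
Proof. exact: cvgM. Qed.

Lemma cvgC_conj f x : f t @[t --> G] --> x -> (f t)^* @[t --> G] --> x^*.
Proof. move=> fx; apply: continuous_cvg fx; exact: continuous_conj. Qed.

Lemma cvgC_real (r : T -> R) (a : R) :
  r t @[t --> G] --> a -> ((r t)%:C : C) @[t --> G] --> (a%:C : C).
Proof. move=> ra; apply: continuous_cvg ra; exact: continuous_real_complex. Qed.

Lemma cvgC_Re f x : f t @[t --> G] --> x -> complex.Re (f t) @[t --> G] --> complex.Re x.
Proof. move=> fx; apply: continuous_cvg fx; exact: continuous_Re. Qed.

Lemma cvgC_Im f x : f t @[t --> G] --> x -> complex.Im (f t) @[t --> G] --> complex.Im x.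
Proof.
have ImE (z : C) : complex.Im z = complex.Re (- 'i * z).
  by rewrite -complexiE; case: z => a b /=; ring.
move=> fx; rewrite ImE; under eq_fun do rewrite ImE.
exact: cvgC_Re (cvgC_M (cvgC_cst (- 'i)) fx).
Qed.

End ComplexLimits.
Arguments cvgC_cst {R T G FG} x.

Section Paths.
Variable R : realType.
Local Notation C := R[i].

(** The segment from [u] to [v] works, unless [v] is a real multiple of [u]; in
    that case one turns around the origin in the complex line of [u]. *)
Lemma nonzero_path n (u v : 'rV[C]_n) : u != 0 -> v != 0 ->
  exists g : R -> 'rV[C]_n,
    [/\ continuous g, g 0 = u, g 1 = v & forall t, g t != 0].
Proof.
have creal (t : R) : (s%:C : C) @[s --> t] --> (t%:C : C).
  exact: continuous_real_complex.
have c1real (t : R) : (1 - s%:C : C) @[s --> t] --> (1 - t%:C : C).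
  exact: cvgC_B (cvgC_cst _) (creal t).
move=> u0 v0; have [[k vE]|indep] := pselect (exists k : R, v = k%:C *: u).
  have k0 : k != 0 by apply: contraNneq v0 => k0; rewrite vE k0 scale0r.
  pose c (t : R) : C := 1 - t%:C + t%:C * k%:C + 'i * (t%:C * (1 - t%:C)).
  exists (fun t => c t *: u); split.
  - move=> t; apply: cvg_entries => i j; rewrite mxE.
    under eq_fun do rewrite mxE.
    apply: cvgC_M (cvgC_cst _); apply: cvgC_D.
      exact: cvgC_D (c1real t) (cvgC_M (creal t) (cvgC_cst _)).
    exact: cvgC_M (cvgC_cst _) (cvgC_M (creal t) (c1real t)).
  - by rewrite /c !(mul0r, mulr0, subr0, addr0) scale1r.
  - by rewrite /c subrr !mulr0 addr0 add0r mul1r.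
  - move=> t; rewrite scaler_eq0 (negbTE u0) orbF.
    have -> : c t = (1 - t + t * k) +i* (t * (1 - t)).
      by apply/eqP; rewrite eq_complex /=; apply/andP; split; apply/eqP; ring.
    rewrite eq_complex /= mulf_eq0 subr_eq0 negb_and.
    have [->|t0] := eqVneq t 0; first by rewrite subr0 mul0r addr0 oner_eq0.
    have [<-|t1] := eqVneq 1 t; first by rewrite subrr add0r mul1r k0.
    by rewrite orbT.
exists (fun t => (1 - t%:C) *: u + t%:C *: v); split.
- move=> t; apply: cvg_entries => i j; rewrite !mxE.
  under eq_fun do rewrite !mxE.
  exact: cvgC_D (cvgC_M (c1real t) (cvgC_cst _)) (cvgC_M (creal t) (cvgC_cst _)).
- by rewrite subr0 scale1r scale0r addr0.
- by rewrite subrr scale0r add0r scale1r.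
- move=> t; apply/negP => /eqP e; have [t0|t0] := eqVneq t 0.
    by move: e; rewrite t0 subr0 scale1r scale0r addr0 => /eqP; exact/negP.
  apply: indep; exists (- ((1 - t) / t)).
  have tC0 : t%:C != 0 :> C by rewrite eq_complex /= negb_and t0.
  apply: (scalerI tC0); apply/eqP.
  rewrite -subr_eq0 scalerA -rmorphM /= mulrN mulrC divfK// rmorphN rmorphB /=.
  by rewrite rmorph1 scaleNr opprK addrC e.
Qed.

End Paths.

(** * Parametrization of the quaternionic frames *)

Section FramePaths.
Variable R : realType.
Local Notation C := R[i].
Implicit Types (p q r s : 'rV[C]_2) (a b v : 'rV[C]_4) (x y : R).

Definition sqnorm2 q : C := q 0 0 * (q 0 0)^* + q 0 1 * (q 0 1)^*.

Lemma sqnorm2_real q : (complex.Re (sqnorm2 q))%:C = sqnorm2 q.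
Proof. by apply: RRe_real; rewrite ger0_real// addr_ge0// mul_conjC_ge0. Qed.

Lemma sqnorm2_ge0 q : 0 <= complex.Re (sqnorm2 q).
Proof. by rewrite -ler0c sqnorm2_real addr_ge0// mul_conjC_ge0. Qed.

Lemma sqnorm2_eq0 q : (complex.Re (sqnorm2 q) == 0) = (q == 0).
Proof.
apply/eqP/eqP => [q0|->]; last by rewrite /sqnorm2 !mxE mul0r addr0.
have /eqP : sqnorm2 q = 0 by rewrite -sqnorm2_real q0.
rewrite paddr_eq0 ?mul_conjC_ge0// !mul_conjC_eq0 => /andP[/eqP q00 /eqP q01].
apply/rowP => -[[|[|//]] lti]; rewrite mxE.
- by rewrite -[RHS]q00; congr (q _ _); apply: val_inj.
- by rewrite -[RHS]q01; congr (q _ _); apply: val_inj.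
Qed.

Lemma sqnorm2Z x q : sqnorm2 (x%:C *: q) = (x ^+ 2)%:C * sqnorm2 q.
Proof. by rewrite /sqnorm2 !mxE !conjC_E rmorphXn /=; ring. Qed.

Lemma sqnorm2_normalize q : q != 0 ->
  sqnorm2 ((Num.sqrt (complex.Re (sqnorm2 q)))^-1%:C *: q) = 1.
Proof.
rewrite -sqnorm2_eq0 => q0; rewrite sqnorm2Z exprVn sqr_sqrtr ?sqnorm2_ge0//.
by rewrite -[sqnorm2 q in X in _ * X]sqnorm2_real -rmorphM /= mulVf.
Qed.

Lemma polar_decomposition2 q : exists p x, sqnorm2 p = 1 /\ q = x%:C *: p.
Proof.
have [->|q0] := eqVneq q 0.
  exists (delta_mx 0 0), 0; rewrite scale0r; split=> //.
  by rewrite /sqnorm2 !mxE /= mul0r addr0 mul1r conjC1.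
have := q0; rewrite -sqnorm2_eq0 => n0.
exists ((Num.sqrt (complex.Re (sqnorm2 q)))^-1%:C *: q).
exists (Num.sqrt (complex.Re (sqnorm2 q))).
split; first exact: sqnorm2_normalize.
rewrite scalerA -rmorphM /= divff ?scale1r// sqrtr_eq0 -ltNge lt_def n0.
exact: sqnorm2_ge0.
Qed.

(** The 3-sphere of unit quaternions is path-connected: normalize a path of
    nonzero vectors. *)
Lemma unit_path p q : sqnorm2 p = 1 -> sqnorm2 q = 1 -> exists g : R -> 'rV[C]_2,
  [/\ continuous g, g 0 = p, g 1 = q & forall t, sqnorm2 (g t) = 1].
Proof.
have neq0 q' : sqnorm2 q' = 1 -> q' != 0.
  by move=> n1; rewrite -sqnorm2_eq0 n1 /= oner_eq0.
move=> p1 q1; have [g [cg g0 g1 gn0]] := nonzero_path (neq0 p p1) (neq0 q q1).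
exists (fun t => (Num.sqrt (complex.Re (sqnorm2 (g t))))^-1%:C *: g t); split.
- move=> t.
  have cgi i : (fun h => g h 0 i) @ t --> g t 0 i.
    exact: cvg_comp (cg t) (@coord_continuous C 1 2 0 i (g t)).
  apply: cvg_entries => i j; rewrite ord1 mxE; under eq_fun do rewrite mxE.
  apply: cvgC_M (cgi j); apply: cvgC_real; apply: cvgV.
    rewrite sqrtr_eq0 -ltNge lt_def sqnorm2_ge0 andbT sqnorm2_eq0; exact: gn0.
  apply: continuous_cvg; first exact: sqrt_continuous.
  apply: cvgC_Re; apply: cvgC_D; apply: cvgC_M => //; exact: cvgC_conj.
- by rewrite g0 p1 /= sqrtr1 invr1 scale1r.
- by rewrite g1 q1 /= sqrtr1 invr1 scale1r.
- by move=> t; exact: sqnorm2_normalize.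
Qed.

(** The vector [(p x, r y)] of H^2, for quaternions [p] and [r]. *)
Definition frame_fst p r x y : 'rV[C]_4 := \row_k
  [:: x%:C * p 0 0; x%:C * p 0 1; y%:C * r 0 0; y%:C * r 0 1]`_k.

(** The vector [(- p y, r x)] of H^2, which is orthogonal to [frame_fst p r x y]
    when [p] and [r] are units, multiplied on the right by the quaternion
    [s], and by the ratio of the norms prescribed by [quat_frame]. *)
Definition frame_snd p r s x y : 'rV[C]_4 :=
  let n := frame_fst p r (- y) x in
  (Num.sqrt 3)%:C *: (s 0 0 *: n + s 0 1 *: quat_j n).

Lemma realC_eq0 x : (x%:C == 0 :> C) = (x == 0).
Proof. by rewrite eq_complex /= eqxx andbT. Qed.

Lemma sqrt3_sqr : (Num.sqrt 3 : R)%:C * (Num.sqrt 3 : R)%:C = 3 :> C.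
Proof. by rewrite -rmorphM -expr2 sqr_sqrtr ?ler0n// rmorph_nat. Qed.

Lemma frame_fst_coord p r x y : ((frame_fst p r x y 0 0 = x%:C * p 0 0)%R *
  (frame_fst p r x y 0 1 = x%:C * p 0 1)%R *
  (frame_fst p r x y 0 2 = y%:C * r 0 0)%R *
  (frame_fst p r x y 0 3 = y%:C * r 0 1)%R)%type.
Proof. by rewrite !mxE. Qed.

Lemma hprod_frame_fst p r x y x' y' : sqnorm2 p = 1 -> sqnorm2 r = 1 ->
  hprod (frame_fst p r x y) (frame_fst p r x' y') = (x * x' + y * y')%:C.
Proof.
rewrite /sqnorm2 => p1 r1; rewrite hprodE !frame_fst_coord !conjC_E.
rewrite rmorphD !rmorphM /= -[X in _ = X + _]mulr1 -[X in _ = _ + X]mulr1.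
by rewrite -{1}p1 -r1; ring.
Qed.

Lemma omega_frame_fst p r x y x' y' :
  omega (frame_fst p r x y) (frame_fst p r x' y') = 0.
Proof. by rewrite /omega !frame_fst_coord; ring. Qed.

Lemma quat_frame_frame p r s x y :
  sqnorm2 p = 1 -> sqnorm2 r = 1 -> sqnorm2 s = 1 -> (x != 0) || (y != 0) ->
  quat_frame (frame_fst p r x y) (frame_snd p r s x y).
Proof.
move=> p1 r1 s1 xy; rewrite /frame_snd.
set a := frame_fst p r x y; set n := frame_fst p r (- y) x.
have an : hprod a n = 0 by rewrite hprod_frame_fst// mulrN mulrC addNr.
have wan : omega a n = 0 by exact: omega_frame_fst.
have aa : hprod a a = (x ^+ 2 + y ^+ 2)%:C by rewrite hprod_frame_fst// -!expr2.
have nn : hprod n n = (x ^+ 2 + y ^+ 2)%:C.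
  by rewrite hprod_frame_fst// mulrNN -!expr2 addrC.
have omegaD u v w : omega u (v + w) = omega u v + omega u w :> C.
  by rewrite /omega !mxE; ring.
split.
- rewrite -hprodvv_eq0 aa realC_eq0 paddr_eq0 ?sqr_ge0//.
  by rewrite !sqrf_eq0 negb_and.
- by rewrite hprodZr hprodDr !hprodZr hprod_quat_j an omegaC wan oppr0 !mulr0 addr0 mulr0.
- by rewrite omegaZr omegaD !omegaZr omega_quat_j an wan !mulr0 addr0 mulr0.
- rewrite hprodZl hprodZr hprodDl !hprodZl !hprodDr !hprodZr.
  rewrite hprod_quat_j2 hprod_quat_j (hprodC n (quat_j n)) hprod_quat_j
    omegavv conjC0 nn aa.
  rewrite conjC_real mulrA sqrt3_sqr -[RHS]mulr1 -s1 /sqnorm2; ring.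
Qed.

(** [p x] and [r y] are polar decompositions of the two quaternions of [a], and [s] is
    determined by [b] because the orthogonal of a quaternionic line of H^2 is a
    quaternionic line. This is the decomposition of Sp(2) as a product of
    diagonal matrices and plane rotations. *)
Lemma quat_frame_surj a b : quat_frame a b -> exists p r s x y,
  [/\ [/\ sqnorm2 p = 1, sqnorm2 r = 1 & sqnorm2 s = 1], (x != 0) || (y != 0),
      a = frame_fst p r x y & b = frame_snd p r s x y].
Proof.
move=> [a0 ab wab bb].
have [p [x [p1 px]]] := polar_decomposition2 (\row_(k < 2) [:: a 0 0; a 0 1]`_k).
have [r [y [r1 ry]]] := polar_decomposition2 (\row_(k < 2) [:: a 0 2; a 0 3]`_k).
have aE : a = frame_fst p r x y.
  apply/rowP; apply: forall_ord4; rewrite frame_fst_coord.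
  - by move/rowP/(_ 0): px; rewrite !mxE.
  - by move/rowP/(_ 1): px; rewrite !mxE.
  - by move/rowP/(_ 0): ry; rewrite !mxE.
  - by move/rowP/(_ 1): ry; rewrite !mxE.
pose n := frame_fst p r (- y) x; pose d := x ^+ 2 + y ^+ 2.
have aa : hprod a a = d%:C by rewrite aE hprod_frame_fst// -!expr2.
have xy : (x != 0) || (y != 0).
  apply: contraNT a0; rewrite negb_or !negbK => /andP[/eqP x0 /eqP y0].
  by rewrite -hprodvv_eq0 aa /d x0 y0 expr0n /= addr0.
have d0 : d%:C != 0 :> C by rewrite -aa hprodvv_eq0.
have nn : hprod n n = d%:C by rewrite hprod_frame_fst// mulrNN -!expr2 addrC.
(* [a], [quat_j a], [n], [quat_j n] is an orthogonal basis of C^4, and [b] is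
   orthogonal to the first two. *)
have decomp : d%:C *: b = hprod b n *: n + hprod b (quat_j n) *: quat_j n.
  have full : forall i, d%:C * b 0 i = hprod b a * a 0 i + omega a b * quat_j a 0 i +
      (hprod b n * n 0 i + omega n b * quat_j n 0 i).
    have dE : d%:C = x%:C * x%:C + y%:C * y%:C :> C.
      by rewrite /d rmorphD !expr2 !rmorphM.
    move: p1 r1; rewrite /sqnorm2 => p1' r1'.
    have yN : (- y)%:C = - y%:C :> C by exact: rmorphN.
    apply: forall_ord4; rewrite -[LHS]mul1r dE.
    - rewrite -[X in X * _ = _]p1'.
      by rewrite aE /n !hprodE /omega !quat_jE !frame_fst_coord yN !conjC_E; ring.
    - rewrite -[X in X * _ = _]p1'.
      by rewrite aE /n !hprodE /omega !quat_jE !frame_fst_coord yN !conjC_E; ring.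
    - rewrite -[X in X * _ = _]r1'.
      by rewrite aE /n !hprodE /omega !quat_jE !frame_fst_coord yN !conjC_E; ring.
    - rewrite -[X in X * _ = _]r1'.
      by rewrite aE /n !hprodE /omega !quat_jE !frame_fst_coord yN !conjC_E; ring.
  apply/rowP => i; rewrite [LHS]mxE full wab (hprodC a b) ab conjC0 !mul0r !add0r.
  by rewrite hprod_quat_j [RHS]mxE ![in RHS](mxE scalemx_key).
pose k : C := (Num.sqrt 3)%:C.
have k0 : k != 0 by rewrite realC_eq0 sqrtr_eq0 -ltNge ltr0n.
pose s : 'rV[C]_2 := \row_(i < 2) ([:: hprod b n; hprod b (quat_j n)]`_i / (k * d%:C)).
exists p, r, s, x, y; split=> //; last first.
  rewrite /frame_snd -/n -/k; apply: (scalerI d0); rewrite decomp.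
  rewrite !mxE /= !scalerDr !scalerA; congr (_ *: _ + _ *: _).
  - by field; rewrite k0 d0.
  - by field; rewrite k0 d0.
split=> //; rewrite /sqnorm2 !mxE /= !conjC_M !conjC_V !conjC_M !conjC_real.
have := congr1 (fun v => hprod v b) decomp.
rewrite hprodZl hprodDl !hprodZl bb aa (hprodC b n) (hprodC b (quat_j n)) => e.
have kk : k * k = 3 by exact: sqrt3_sqr.
transitivity ((d%:C * (3 * d%:C)) / (k * k * d%:C * d%:C)).
  by rewrite e; field; rewrite k0 d0.
by rewrite kk; field.
Qed.

End FramePaths.

(** * Paths of frames *)

Section FrameContinuity.
Variable R : realType.
Local Notation C := R[i].
Variables (T : Type) (G : set_system T).
Context {FG : Filter G}.

Lemma cvg_entry m n (F : T -> 'M[C]_(m, n)) (M : 'M[C]_(m, n)) i j :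
  F @ G --> M -> F t i j @[t --> G] --> M i j.
Proof. move=> FM; exact: cvg_comp FM (@coord_continuous C m n i j M). Qed.

Lemma cvg_rV4 (f : T -> 'rV[C]_4) (v : 'rV[C]_4) :
  f t 0 0 @[t --> G] --> v 0 0 -> f t 0 1 @[t --> G] --> v 0 1 ->
  f t 0 2 @[t --> G] --> v 0 2 -> f t 0 3 @[t --> G] --> v 0 3 -> f @ G --> v.
Proof.
move=> f0 f1 f2 f3; apply: cvg_entries => i j; rewrite ord1.
exact: (@forall_ord4 (fun j => f t 0 j @[t --> G] --> v 0 j)).
Qed.

Lemma cvg_quat_j (f : T -> 'rV[C]_4) (v : 'rV[C]_4) :
  f @ G --> v -> quat_j (f t) @[t --> G] --> quat_j v.
Proof.
move=> fv; apply: cvg_rV4; rewrite quat_jE; under eq_fun do rewrite quat_jE.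
- apply: cvgC_N; apply: cvgC_conj; exact: cvg_entry fv.
- apply: cvgC_conj; exact: cvg_entry fv.
- apply: cvgC_N; apply: cvgC_conj; exact: cvg_entry fv.
- apply: cvgC_conj; exact: cvg_entry fv.
Qed.

Lemma cvg_frame_mx (f g : T -> 'rV[C]_4) (a b : 'rV[C]_4) :
  f @ G --> a -> g @ G --> b -> frame_mx (f t) (g t) @[t --> G] --> frame_mx a b.
Proof.
move=> fa gb; apply: cvg_entries => i.
apply: (@forall_ord4 (fun j => frame_mx (f t) (g t) i j @[t --> G] --> frame_mx a b i j)).
- rewrite mxE /=; under eq_fun do rewrite mxE /=; exact: cvg_entry.
- rewrite mxE /=; under eq_fun do rewrite mxE /=; exact: cvg_entry.
- rewrite mxE [nth _ _ _]/= mxE.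
  under eq_fun do rewrite mxE [nth _ _ _]/= mxE.
  by apply: cvgC_N; apply: cvg_entry; exact: cvg_quat_j.
- rewrite mxE [nth _ _ _]/=; under eq_fun do rewrite mxE [nth _ _ _]/=.
  by apply: cvg_entry; exact: cvg_quat_j.
Qed.

Lemma cvg_frame_fst (f g : T -> 'rV[C]_2) (h k : T -> R)
    (p r : 'rV[C]_2) (x y : R) :
  f @ G --> p -> g @ G --> r -> h @ G --> x -> k @ G --> y ->
  frame_fst (f t) (g t) (h t) (k t) @[t --> G] --> frame_fst p r x y.
Proof.
move=> fp gr hx ky; apply: cvg_rV4; rewrite frame_fst_coord;
  under eq_fun do rewrite frame_fst_coord;
  (apply: cvgC_M; first exact: cvgC_real);
  (exact: cvg_entry fp || exact: cvg_entry gr).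
Qed.

Lemma cvg_frame_snd (f g l : T -> 'rV[C]_2) (h k : T -> R)
    (p r s : 'rV[C]_2) (x y : R) :
  f @ G --> p -> g @ G --> r -> l @ G --> s -> h @ G --> x -> k @ G --> y ->
  frame_snd (f t) (g t) (l t) (h t) (k t) @[t --> G] --> frame_snd p r s x y.
Proof.
move=> fp gr ls hx ky; apply: cvg_entries => i j; rewrite ord1.
pose n t := frame_fst (f t) (g t) (- k t) (h t).
have nn : n @ G --> frame_fst p r (- y) x.
  by apply: cvg_frame_fst => //; exact: cvgN.
have e p' r' s' x' y' : frame_snd p' r' s' x' y' 0 j = (Num.sqrt 3)%:C *
    (s' 0 0 * frame_fst p' r' (- y') x' 0 j
     + s' 0 1 * quat_j (frame_fst p' r' (- y') x') 0 j).
  rewrite /frame_snd; move: (frame_fst _ _ _ _) => u; move: (quat_j u) => w.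
  by rewrite !mxE.
rewrite e; under eq_fun do rewrite e.
apply: cvgC_M; first exact: cvgC_cst.
apply: cvgC_D; apply: cvgC_M.
- exact: cvg_entry ls.
- exact: cvg_entry nn.
- exact: cvg_entry ls.
- exact: cvg_entry (cvg_quat_j nn).
Qed.

End FrameContinuity.

(** The parameters of [quat_frame_surj] range over path-connected sets: three
    3-spheres and a punctured plane. *)
Lemma frame_mx_path (R : realType) (a b a' b' : 'rV[R[i]]_4) :
  quat_frame a b -> quat_frame a' b' -> exists M : R -> 'M[R[i]]_(4, 4),
  [/\ continuous M, M 0 = frame_mx a b, M 1 = frame_mx a' b' &
      forall t, exists2 f, quat_frame f.1 f.2 & M t = frame_mx f.1 f.2].
Proof.
move=> /quat_frame_surj[p [r [s [x [y [[p1 r1 s1] xy -> ->]]]]]].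
move=> /quat_frame_surj[p' [r' [s' [x' [y' [[p1' r1' s1'] xy' -> ->]]]]]].
have [P [cP P0 P1 Pn]] := unit_path p1 p1'.
have [Q [cQ Q0 Q1 Qn]] := unit_path r1 r1'.
have [S [cS S0 S1 Sn]] := unit_path s1 s1'.
have z0 (u v : R) : (u != 0) || (v != 0) -> (const_mx (u +i* v) : 'rV[R[i]]_1) != 0.
  apply: contraTneq => /rowP/(_ 0)/eqP; rewrite !mxE eq_complex /=.
  move=> /andP[/eqP -> /eqP ->].
  by rewrite eqxx.
have [z [cz zz0 zz1 zn]] := nonzero_path (z0 x y xy) (z0 x' y' xy').
pose h t := complex.Re (z t 0 0); pose k t := complex.Im (z t 0 0).
exists (fun t => frame_mx (frame_fst (P t) (Q t) (h t) (k t))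
                      (frame_snd (P t) (Q t) (S t) (h t) (k t))); split.
- move=> t.
  have hh : h @ t --> h t by apply: cvgC_Re; exact: cvg_entry (cz t).
  have kk : k @ t --> k t by apply: cvgC_Im; exact: cvg_entry (cz t).
  apply: cvg_frame_mx.
    exact: cvg_frame_fst (cP t) (cQ t) hh kk.
  exact: cvg_frame_snd (cP t) (cQ t) (cS t) hh kk.
- by rewrite P0 Q0 S0 /h /k zz0 !mxE.
- by rewrite P1 Q1 S1 /h /k zz1 !mxE.
- move=> t; exists (frame_fst (P t) (Q t) (h t) (k t),
                    frame_snd (P t) (Q t) (S t) (h t) (k t)) => //=.
  apply: quat_frame_frame => //; rewrite -negb_and; apply: contra (zn t).
  move=> /andP[/eqP h0 /eqP k0]; apply/eqP/rowP => i; rewrite ord1 mxE.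
  by apply/eqP; rewrite eq_complex /=; apply/andP; split; apply/eqP.
Qed.

(** * Continuity of the twistor fibration; discs *)

Section TwistorContinuity.
Variable R : realType.
Local Notation C := R[i].

Lemma cvg_twistor (T : Type) (G : set_system T) (FG : Filter G)
    (f : T -> 'rV[C]_4) (v : 'rV[C]_4) :
  v != 0 -> f @ G --> v -> twistor (f t) @[t --> G] --> twistor v.
Proof.
move=> v0 fv; have fi i : f t 0 i @[t --> G] --> v 0 i by exact: cvg_entry fv.
have fA : tw_a (f t) @[t --> G] --> tw_a v.
  exact: cvgC_D (cvgC_M (cvgC_conj (fi 0)) (fi 2)) (cvgC_M (fi 1) (cvgC_conj (fi 3))).
have fB : tw_b (f t) @[t --> G] --> tw_b v.
  exact: cvgC_B (cvgC_M (cvgC_conj (fi 0)) (fi 3)) (cvgC_M (fi 1) (cvgC_conj (fi 2))).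
have sq i : f t 0 i * (f t 0 i)^* @[t --> G] --> v 0 i * (v 0 i)^*.
  exact: cvgC_M (fi i) (cvgC_conj (fi i)).
have fP : tw_p (f t) @[t --> G] --> tw_p v by exact: cvgC_D (sq 0) (sq 1).
have fQ : tw_q (f t) @[t --> G] --> tw_q v by exact: cvgC_D (sq 2) (sq 3).
have fN : (complex.Re (hprod (f t) (f t)))^-1 @[t --> G] --> (complex.Re (hprod v v))^-1.
  apply: cvgV; first exact: Re_hprodvv_neq0.
  rewrite hprodvvE; under eq_fun do rewrite hprodvvE.
  exact: cvgC_Re (cvgC_D fP fQ).
apply: cvg_entries => i k; rewrite ord1 twistorE mxE.
under eq_fun do rewrite twistorE mxE.
apply: cvgM fN; case: k => [[|[|[|[|[|k]]]]] ltk] //=.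
- exact: cvgC_Re (cvgC_M (cvgC_cst 2) fA).
- exact: cvgC_Im (cvgC_M (cvgC_cst 2) fA).
- exact: cvgC_Re (cvgC_M (cvgC_cst 2) fB).
- exact: cvgC_Im (cvgC_M (cvgC_cst 2) fB).
- exact: cvgC_Re (cvgC_B fP fQ).
Qed.

Lemma cvg_hlift (T : Type) (G : set_system T) (FG : Filter G)
    (M : T -> 'M[C]_(4, 4)) (h : T -> C) (A : 'M[C]_(4, 4)) (z : C) :
  M @ G --> A -> h @ G --> z -> @hlift R 3 (M t) (h t) @[t --> G] --> @hlift R 3 A z.
Proof.
move=> MA hz; apply: cvg_entries => i j; rewrite ord1 hlift_coord.
under eq_fun do rewrite hlift_coord !exprS !expr0.
rewrite !exprS !expr0.
have Mi k : M t j k @[t --> G] --> A j k by exact: cvg_entry MA.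
have h1 : h t * 1 @[t --> G] --> z * 1 by exact: cvgC_M hz (cvgC_cst 1).
have h2 : h t * (h t * 1) @[t --> G] --> z * (z * 1) by exact: cvgC_M hz h1.
have h3 : h t * (h t * (h t * 1)) @[t --> G] --> z * (z * (z * 1)) by exact: cvgC_M hz h2.
exact: cvgC_D (cvgC_D (cvgC_D (Mi 0) (cvgC_M hz (Mi 1))) (cvgC_M h2 (Mi 2)))
  (cvgC_M h3 (Mi 3)).
Qed.

Definition disc (r : R) : set C := [set z | complex.Re (z * z^*) <= r].

Lemma closed_disc r : closed (disc r).
Proof.
apply: (@preimage_closed _ _ (fun z : C => complex.Re (z * z^*)) [set x | x <= r]);
  last exact: closed_le.
move=> z _; have zz : id @ z --> z by exact: cvg_id.
exact: cvgC_Re (cvgC_M zz (cvgC_conj zz)).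
Qed.

(** A disc is closed and contained in the image of a square, which is compact. *)
Lemma compact_disc r : compact (disc r).
Proof.
pose s := Num.sqrt r.
pose f (xy : R * R) : C := xy.1%:C + 'i * xy.2%:C.
have cf : continuous f.
  move=> xy; apply: cvgC_D; first by apply: cvgC_real; exact: cvg_fst.
  by apply: cvgC_M; [exact: cvgC_cst|apply: cvgC_real; exact: cvg_snd].
pose K := `[- s, s]%classic `*` `[- s, s]%classic.
apply: (@subclosed_compact _ (disc r) (f @` K)); first exact: closed_disc.
  apply: continuous_compact (continuous_subspaceT cf) _.
  apply: compact_setX; exact: segment_compact.
case=> x y; rewrite /disc /= mulrN opprK -!expr2 => xyr.
exists (x, y); last first.
  by apply/eqP; rewrite /f -complexiE eq_complex /=; apply/andP; split; apply/eqP; ring.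
have sqb t : t ^+ 2 <= r -> t \in `[- s, s].
  by move=> tr; rewrite in_itv /= -ler_norml -sqrtr_sqr ler_wsqrtr.
split; apply: sqb; apply: le_trans xyr.
  by rewrite lerDl sqr_ge0.
by rewrite lerDr sqr_ge0.
Qed.

End TwistorContinuity.

(** * Continuity of the curve in the compact-open topology *)

Section CurveContinuity.
Variable R : realType.
Local Notation C := R[i].

Lemma hlift_chart_oo (A : 'M[C]_(4, 4)) z : z != 0 ->
  @hlift R 3 A z = z ^+ 3 *: @hlift R 3 (@chart_oo R 3 A) z^-1.
Proof.
move=> z0; rewrite [in RHS]hliftE !coefv_chart_oo.
have -> : rev_ord (0 : 'I_4) = 3 by apply: val_inj.
have -> : rev_ord (1 : 'I_4) = 2 by apply: val_inj.
have -> : rev_ord (2 : 'I_4) = 1 by apply: val_inj.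
have -> : rev_ord (3 : 'I_4) = 0 by apply: val_inj.
by rewrite hliftE; apply/rowP => i; rewrite !mxE; field.
Qed.

(** At infinity, the curve is read in the coordinate [1 / z]: the components
    are multiplied by [z ^ 3], which does not change the value of [twistor], and the
    neighbourhoods of infinity are the complements of compact sets, such as discs. *)
Lemma twistor_curve_jointly_continuous (M : R -> 'M[C]_(4, 4)) :
  continuous M -> (forall t, M t \in unitmx) ->
  continuous (fun tp : R * sphere2 R => twistor_curve (M tp.1) tp.2).
Proof.
move=> cM Mu [t p] B nB; move: p nB.
have cM1 (w : C) : M x.1 @[x --> (t, w)] --> M t.
  have fstt : (fun x : R * C => x.1) @ (t, w) --> t by exact: cvg_fst.
  exact: cvg_comp fstt (cM t).
move=> [z|] /= nB.
  have : \forall tw \near (t, z), B (twistor_curve (M tw.1) (Some tw.2)).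
    apply: (@cvg_twistor R _ (nbhs (t, z)) _ _ (@hlift R 3 (M t) z) _ _ B nB).
      exact: hlift_neq0.
    by apply: cvg_hlift; [exact: cM1|exact: cvg_snd].
  case=> [[U V] /= [Ut Vz] UV]; exists (U, Some @` V).
    by split=> //; exact: one_point_compactification_some_nbhs.
  by move=> [t' p] /= [Ut' [w Vw <-]]; exact: (UV (t', w)).
pose G (tw : R * C) := twistor (@hlift R 3 (@chart_oo R 3 (M tw.1)) tw.2).
have : \forall tw \near (t, 0 : C), B (G tw).
  apply: (@cvg_twistor R _ (nbhs (t, 0 : C)) _ _
    (@hlift R 3 (@chart_oo R 3 (M t)) 0) _ _ B nB).
    exact: (curve_neq0 None (Mu t)).
  apply: cvg_hlift; last exact: cvg_snd.
  apply: cvg_entries => i j; rewrite mxE; under eq_fun do rewrite mxE.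
  exact: cvg_entry (cM1 0).
case=> [[U V] /= [Ut V0] UV].
move: V0 => /nbhs_ballP[e /= e0 eV].
have eE : (complex.Re e)%:C = e by apply: RRe_real; exact: gtr0_real.
have Re0 : 0 < complex.Re e by rewrite -ltcR eE.
(* Outside of this disc, [1 / w] is in the ball of radius [e]. *)
pose K := disc ((complex.Re e)^-1 ^+ 2).
exists (U, (Some @` (~` K)) `|` [set None]).
  split=> //; exists K => //; split; [exact: compact_disc|exact: closed_disc].
move=> [t' p] /= [Ut' [[w Kw <-]|->]]; last first.
  by apply: (UV (t', 0)); split=> //; apply: eV; exact: ballxx.
have ew : e^-1 < `|w|.
  move/negP: Kw; rewrite -ltNge -ltcR => Kw.
  rewrite -(@ltr_pXn2r _ 2)// ?nnegrE ?invr_ge0 ?(ltW e0)// normCK.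
  have -> : e^-1 ^+ 2 = ((complex.Re e)^-1 ^+ 2)%:C.
    by rewrite -[in LHS]eE -fmorphV -rmorphXn.
  by rewrite -(RRe_real (ger0_real (mul_conjC_ge0 w))).
have w0 : w != 0 by rewrite -normr_gt0; apply: lt_trans ew; rewrite invr_gt0.
rewrite /twistor_curve /= hlift_chart_oo// twistorZ ?expf_neq0//; last first.
  have := hlift_neq0 w (Mu t'); rewrite hlift_chart_oo//.
  by rewrite scaler_eq0 negb_or => /andP[].
apply: (UV (t', w^-1)); split=> //=; apply: eV.
rewrite /ball /= sub0r normrN normfV.
by rewrite -[X in _ < X]invrK ltf_pV2 // posrE ?invr_gt0 ?normr_gt0.
Qed.

Lemma twistor_curve_continuous (M : R -> 'M[C]_(4, 4)) :
  continuous M -> (forall t, M t \in unitmx) ->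
  continuous (fun t => twistor_curve (M t)).
Proof.
move=> cM Mu; have := twistor_curve_jointly_continuous cM Mu.
exact: continuous_curry_fun.
Qed.

End CurveContinuity.

(** * Classes in the projective space *)

Section ProjectiveSpace.
Variables (R : realType) (m n : nat).
Local Notation C := R[i].
Local Notation P := (projspace R m n).

Definition proj_class (A : 'M[C]_(m, n)) (A0 : A != 0) : P :=
  \pi_P (exist _ A (mem_set A0) : @nonzero_mx R m n).

Lemma proj_class_continuous (M : R -> 'M[C]_(m, n)) (M0 : forall t, M t != 0) :
  continuous M -> continuous (fun t => proj_class (M0 t)).
Proof.
move=> cM t; apply: (@continuous_comp _ _ _
  (fun t => exist _ (M t) (mem_set (M0 t)) : @nonzero_mx R m n) (\pi_P)).
  exact: continuous_comp_initial.
exact: pi_continuous.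
Qed.

Lemma proj_class_repr (psi : P) (A0 : set_val (repr psi) != 0) : proj_class A0 = psi.
Proof.
rewrite -[RHS]reprK; congr (\pi_P _).
by case: (repr psi) A0 => B B0 A0; apply: val_inj.
Qed.

Lemma proj_class_eq (A B : 'M[C]_(m, n)) (A0 : A != 0) (B0 : B != 0) k :
  k != 0 -> A = k *: B -> proj_class A0 = proj_class B0.
Proof.
by move=> k0 AB; apply/eqmodP/asboolP; exists k.
Qed.

Lemma repr_proj_class (A : 'M[C]_(m, n)) (A0 : A != 0) :
  exists2 k, k != 0 & set_val (repr (proj_class A0)) = k *: A.
Proof.
have /eqmodP/asboolP[k k0 e] : repr (proj_class A0) = exist _ A (mem_set A0) %[mod P].
  by rewrite reprK.
by exists k.
Qed.

End ProjectiveSpace.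

(** * Path-connectedness *)

Section MainTheorem.
Variable R : realType.
Local Notation C := R[i].
Local Notation P3C := (projspace R 4 4).
Implicit Types (A : 'M[C]_(4, 4)).

Lemma twistor_curveZ A k : k != 0 -> A \in unitmx ->
  twistor_curve (k *: A) = twistor_curve A.
Proof.
move=> k0 Au; apply/funext => p; rewrite /twistor_curve.
have -> : @curve R 3 (k *: A) p = k *: @curve R 3 A p.
  case: p => [z|]; last by rewrite !curve_oo coefvZ.
  by rewrite /curve !hliftE !coefvZ !scalerDr !scalerA !(mulrC k).
by rewrite twistorZ ?curve_neq0.
Qed.

Lemma AHHolLFE (psi : P3C) : AHHolLF psi <-> antipodal_cubic (@coefs R 3 psi).
Proof. by split=> [[[? ? ?] ?]|[]]. Qed.

Lemma frame_mx_neq0 a b : quat_frame a b -> frame_mx a b != 0 :> 'M[C]_(4, 4).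
Proof.
case=> a0 _ _ _; apply: contraNneq a0 => M0; apply/eqP.
by rewrite -(frame_mxE a b) M0; apply/rowP => i; rewrite !mxE.
Qed.

(** The path is one of matrices, so that it can be projected both to the
    projective space and to the space of harmonic maps. *)
Lemma antipodal_cubic_path (psi psi' : P3C) : AHHolLF psi -> AHHolLF psi' ->
  exists M : R -> 'M[C]_(4, 4), exists M0 : forall t, M t != 0,
  [/\ continuous M, proj_class (M0 0) = psi, proj_class (M0 1) = psi',
      forall t, M t \in unitmx & forall t, AHHolLF (proj_class (M0 t) : P3C)].
Proof.
move=> /AHHolLFE/antipodal_cubic_frame[k [a [b [k0 psiE ab]]]].
move=> /AHHolLFE/antipodal_cubic_frame[k' [a' [b' [k0' psiE' ab']]]].
have [M [cM M0 M1 Mf]] := frame_mx_path ab ab'.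
have Mn0 t : M t != 0 by have [f ff ->] := Mf t; exact: frame_mx_neq0.
have recover t (phi : P3C) c : c != 0 -> @coefs R 3 phi = c *: M t ->
    proj_class (Mn0 t) = phi.
  move=> c0 e; have phi0 : set_val (repr phi) != 0.
    by move: e; rewrite /coefs => ->; rewrite scaler_eq0 negb_or c0 Mn0.
  by rewrite -(proj_class_repr phi0); symmetry; exact: proj_class_eq c0 e.
exists M, Mn0; split=> //.
- by apply: recover k0 _; rewrite M0.
- by apply: recover k0' _; rewrite M1.
- by move=> t; have [f ff ->] := Mf t; exact: frame_unitmx.
- move=> t; apply/AHHolLFE; have [l l0] := repr_proj_class (Mn0 t).
  rewrite /coefs => ->; have [f ff ->] := Mf t.
  exact: frame_antipodal_cubic.
Qed.

Lemma AHHolLF_neq0 : @AHHolLF R 3 !=set0.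
Proof.
have one : sqnorm2 (delta_mx 0 0 : 'rV[C]_2) = 1.
  by rewrite /sqnorm2 !mxE /= mul0r addr0 mul1r conjC1.
have ab := @quat_frame_frame R _ _ _ 1 0 one one one
  (introT orP (or_introl (oner_neq0 _))).
exists (proj_class (frame_mx_neq0 ab)); apply/AHHolLFE.
have [l l0] := repr_proj_class (frame_mx_neq0 ab); rewrite /coefs => ->.
exact: frame_antipodal_cubic.
Qed.

Lemma AHHolLF_path_connected : path_connected R (@AHHolLF R 3).
Proof.
split; first exact: AHHolLF_neq0.
move=> psi psi' hpsi hpsi'.
have [M [Mn0 [cM M0 M1 Mu Mh]]] := antipodal_cubic_path hpsi hpsi'.
exists (fun t => proj_class (Mn0 t)); split=> //.
by apply: continuous_subspaceT; exact: proj_class_continuous.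
Qed.

(** With [F] the identity or the opposite, this covers the two spaces of
    harmonic maps. *)
Lemma twistor_image_path_connected (F : {compact-open, sphere2 R -> 'rV[R]_5} ->
    {compact-open, sphere2 R -> 'rV[R]_5}) :
  (forall M : R -> 'M[C]_(4, 4), continuous M -> (forall t, M t \in unitmx) ->
     continuous (fun t => F (twistor_curve (M t)))) ->
  path_connected R [set F (twistor_curve (@coefs R 3 psi)) | psi in @AHHolLF R 3].
Proof.
move=> cF; split.
  by have [psi hpsi] := AHHolLF_neq0; exists (F (twistor_curve (coefs psi))), psi.
move=> _ _ [psi hpsi <-] [psi' hpsi' <-].
have [M [Mn0 [cM M0 M1 Mu Mh]]] := antipodal_cubic_path hpsi hpsi'.
have E t : twistor_curve (coefs (proj_class (Mn0 t))) = twistor_curve (M t)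
    :> (sphere2 R -> _).
  by rewrite /coefs; have [k k0 ->] := repr_proj_class (Mn0 t); exact: twistor_curveZ.
exists (fun t => F (twistor_curve (M t))); split.
- by apply: continuous_subspaceT; exact: cF.
- by rewrite -E M0.
- by rewrite -E M1.
- by move=> t _; exists (proj_class (Mn0 t)); rewrite ?E.
Qed.

Lemma AHarm_plusE : @AHarm_plus R 3 =
  [set twistor_curve (@coefs R 3 psi) | psi in @AHHolLF R 3].
Proof.
apply/seteqP; split=> [_ [[psi hpsi <-] inv]|_ [psi [hpsi inv] <-]]; first by exists psi.
by split=> //; exists psi.
Qed.

Lemma AHarm_minusE : @AHarm_minus R 3 =
  [set (fun p => - twistor_curve (@coefs R 3 psi) p) | psi in @AHHolLF R 3].
Proof.
apply/seteqP; split=> [_ [[psi hpsi <-] inv]|_ [psi [hpsi inv] <-]].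
  exists psi => //; split=> // p; apply: oppr_inj; exact: inv.
by split; [exists psi|move=> p; rewrite inv].
Qed.

End MainTheorem.

Theorem corollary6p2 (R : realType) :
  [/\ path_connected R (@AHHolLF R 3),
      path_connected R (@AHarm_plus R 3) &
      path_connected R (@AHarm_minus R 3)].
Proof.
split.
- exact: AHHolLF_path_connected.
- rewrite AHarm_plusE; apply: (@twistor_image_path_connected R id).
  exact: twistor_curve_continuous.
- rewrite AHarm_minusE; apply: (@twistor_image_path_connected R (fun g p => - g p)).
  move=> M cM Mu.
  apply: (@continuous_curry_fun _ _ _
    (fun tp : R * sphere2 R => - twistor_curve (M tp.1) tp.2)).
  move=> tp; apply: cvgN; exact: twistor_curve_jointly_continuous.
Qed.
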